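(* Let $r\geq 2$ and $n\geq r$ be integers, set $\alpha:=\left\lfloor \frac{n+1}{r+1}\right\rfloor$, and write $r=2^{\lambda_1}+\dots+2^{\lambda_s}+\varepsilon$ with integers $\lambda_1>\lambda_2>\dots>\lambda_s\geq 1$ and $\varepsilon\in\{0,1\}$. Let $h\geq 1$ be an integer. If either - $h\leq (\alpha-1)(\alpha^{\lambda_1-1}+\dots+\alpha^{\lambda_s-1})+1$, or - $n\geq r^2+3r+1$ and $h\leq \alpha^{\lambda_1}+\dots+\alpha^{\lambda_s}+1$, then the Grassmannian $\mathbb{G}(r,n)$ of $r$-planes in $\mathbb{P}^n$, in its Plücker embedding, is not $h$-defective.
   Context: We work over $\mathbb{C}$. $\mathbb{G}(r,n)$ is the Grassmannian of $r$-dimensional projective linear subspaces of $\mathbb{P}^n$, embedded in $\mathbb{P}^N=\mathbb{P}(\bigwedge^{r+1}\mathbb{C}^{n+1})$, $N=\binom{n+1}{r+1}-1$, by the Plücker embedding; its dimension is $(r+1)(n-r)$. For an irreducible variety $X\subset\mathbb{P}^N$, the $h$-secant variety $\mathbb{S}ec_h(X)\subset\mathbb{P}^N$ is the Zariski closure of the union of the linear spans of collections of $h$ points of $X$. $X$ is $h$-defective if $\dim \mathbb{S}ec_h(X)<\min\{h\dim X+h-1,\,N\}$. *)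

(* Defs.v *)
From HB Require Import structures.
From mathcomp Require Import all_boot all_order all_algebra.
From mathcomp Require Import mpoly complex.
From mathcomp Require Import boolp classical_sets reals.

Set Implicit Arguments.
Unset Strict Implicit.
Unset Printing Implicit Defensive.

Import GRing.Theory.
Local Open Scope ring_scope.
Local Open Scope classical_set_scope.

(* A subset of P^N over F is encoded by the set of all homogeneous coordinate
   vectors (nonzero elements of F^(N+1)) of its points. *)

Section Projective.
Variables (F : fieldType) (N : nat).
Implicit Types (X Z : set 'rV[F]_N.+1).

Definition proj_closed Z : Prop :=
  exists S : set {mpoly F[N.+1]},
    (forall p, S p -> exists d, p \is d.-homog) /\
    Z = [set v : 'rV[F]_N.+1 | v != 0 /\ forall p, S p -> p.@[fun i => v 0 i] = 0].

Definition zariski_closure X : set 'rV[F]_N.+1 :=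
  [set v | forall Z, proj_closed Z -> X `<=` Z -> Z v].

Definition irreducible_set X : Prop :=
  X !=set0 /\
  forall Z1 Z2, proj_closed Z1 -> proj_closed Z2 ->
    X `<=` Z1 `|` Z2 -> X `<=` Z1 \/ X `<=` Z2.

Definition closed_in X Z : Prop :=
  exists2 W, proj_closed W & Z = X `&` W.

Definition irreducible_chain X (d : nat) (Z : 'I_d.+1 -> set 'rV[F]_N.+1) :=
  (forall i, closed_in X (Z i) /\ irreducible_set (Z i)) /\
  (forall i j : 'I_d.+1, (i < j)%N -> Z i `<` Z j).

Definition has_dim X (d : nat) : Prop :=
  (exists Z : 'I_d.+1 -> _, irreducible_chain X Z) /\
  (forall (e : nat) (Z : 'I_e.+1 -> _), irreducible_chain X Z -> (e <= d)%N).

(* Krull dimension of X for the Zariski topology; the default value 0 is only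
   taken on the empty set. *)
Definition proj_dim X : nat := xget 0%N [set d | has_dim X d].

(* The row space of M is the span of the h points of X given by its rows. *)
Definition secant h X : set 'rV[F]_N.+1 :=
  zariski_closure
    [set v : 'rV[F]_N.+1 | v != 0 /\
       exists M : 'M[F]_(h, N.+1), (forall i, X (row i M)) /\ (v <= M)%MS].

Definition defective h X : Prop :=
  (proj_dim (secant h X) < minn (h * proj_dim X + h - 1) N)%N.

End Projective.

Section Grassmannian.
Variables (F : fieldType) (r n : nat).

Definition plucker_dim : nat := 'C(n.+1, r.+1).-1.

(* The maximal minor of M on the columns indexed by S, in increasing order. *)
Definition plucker_coord (M : 'M[F]_(r.+1, n.+1)) (S : {set 'I_n.+1}) : F :=
  \det (colsub (fun j : 'I_r.+1 => nth ord0 (enum S) j) M).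

Definition plucker (M : 'M[F]_(r.+1, n.+1)) : 'rV[F]_(plucker_dim.+1) :=
  \row_k plucker_coord M
    (nth finset.set0 (enum [set S : {set 'I_n.+1} | #|S| == r.+1]%SET) k).

(* An r-plane of P^n is the row space of some M of rank r+1; as M runs over
   the bases of this space, plucker M runs over all homogeneous coordinate
   vectors of its Plucker point. *)
Definition grassmannian : set 'rV[F]_(plucker_dim.+1) :=
  [set p | exists2 M : 'M[F]_(r.+1, n.+1), row_free M & p = plucker M].

End Grassmannian.

Arguments grassmannian F r n : clear implicits.

(* Main.v *)
(* By Terracini's argument the secant variety has the expected dimension as soon as the
   tangent spaces of the Grassmannian at some h points are linearly independent. The tangent
   space at a coordinate point e_I is spanned by the e_J with |I \ J| <= 1, so coordinate
   points indexed by sets that pairwise differ in at least three elements suffice. Such sets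
   come from codes of length r+1 and minimum distance 3 over an alphabet with alpha letters,
   built from (x, y, z, x+y, y+z, x+z) and repetitions; when alpha > r one more set lies inside
   a single block. Only for r = 2 and h = alpha + 1 is a point needed that is not a coordinate
   point.

   Krull dimensions are compared through Hilbert functions. In a chain of irreducible closed
   sets each step raises the order of growth of the Hilbert function, while a set that is
   dominated by a polynomial map from F^D has growth at most d^D; conversely a polynomial map
   with injective differential at a point sends a flag of coordinate subspaces to a chain,
   because the Hilbert functions of the images have different growth. *)

From HB Require Import structures.
Require Import Defs.
From mathcomp Require Import all_boot all_order all_algebra perm.
From mathcomp Require Import complex reals mpoly.
From mathcomp Require Import boolp classical_sets.
From mathcomp Require Import zify ring.

Set Implicit Arguments.
Unset Strict Implicit.
Unset Printing Implicit Defensive.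

Import GRing.Theory Num.Theory.
Local Open Scope ring_scope.

(** * Polynomial functions *)

(** Uniqueness of digits in base [b]: it keeps distinct exponent vectors distinct under Kronecker's
    substitution. *)
Lemma base_expansion_inj (b n : nat) (u v : 'I_n -> nat) :
    (forall i, u i < b)%N -> (forall i, v i < b)%N ->
    (\sum_i u i * b ^ i = \sum_i v i * b ^ i)%N -> u =1 v.
Proof.
elim: n u v => [|n IH] u v ub vb; first by move=> _ [].
have split w : (\sum_(i < n.+1) w i * b ^ i =
    (\sum_(i < n) w (lift ord0 i) * b ^ i) * b + w ord0)%N.
  rewrite big_ord_recl expn0 muln1 addnC big_distrl /=; congr (_ + _)%N.
  by apply: eq_bigr => i _; rewrite /bump /= add1n expnSr mulnA.
rewrite !split => E; have b_gt0 : (0 < b)%N by apply: leq_ltn_trans (ub ord0).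
have E0 : u ord0 = v ord0.
  by have := congr1 (modn^~ b) E; rewrite /= !modnMDl !modn_small.
have {}IH : (fun i => u (lift ord0 i)) =1 (fun i => v (lift ord0 i)).
  apply: IH => // {ub vb split}; move/eqP: E; rewrite E0 eqn_add2r eqn_pmul2r //.
  by move=> /eqP.
by move=> i; case: (unliftP ord0 i) => [j ->|->] //; apply: IH.
Qed.

Section PolynomialFunctions.
Variable F : numFieldType.

(** In characteristic zero the elements [0, 1, 2, ...] are distinct, so there are [size q] roots,
    more than a nonzero [q] allows. *)
Lemma poly_eval_eq0 (q : {poly F}) : (forall t, q.[t] = 0) -> q = 0.
Proof.
move=> q0; apply/eqP; case: eqP => // /eqP q_neq0.
pose s := [seq (i%:R : F) | i <- iota 0 (size q)].
have := @max_poly_roots _ q s q_neq0; rewrite size_map size_iota ltnn; apply.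
  by apply/allP => t _; rewrite rootE q0.
by rewrite map_inj_uniq ?iota_uniq // => i j /eqP; rewrite eqr_nat => /eqP.
Qed.

(* Kronecker's substitution [x_i := t ^ (b ^ i)] separates the monomials. *)
Lemma mpoly_eval_eq0 n (p : {mpoly F[n]}) : (forall v, p.@[v] = 0) -> p = 0.
Proof.
move=> p0; pose b := msize p; pose w (m : 'X_{1..n}) := (\sum_i m i * b ^ i)%N.
have digit m : m \in msupp p -> forall i, (m i < b)%N.
  move=> /msize_mdeg_lt m_lt i; apply: leq_ltn_trans m_lt.
  by rewrite mdegE (bigD1 i) //= leq_addr.
have q0 : \sum_(m <- msupp p) p@_m *: 'X^(w m) = 0.
  apply: poly_eval_eq0 => t; rewrite horner_sum -[RHS](p0 (fun i => t ^+ (b ^ i))).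
  rewrite mevalE; apply: eq_bigr => m _; rewrite hornerZ hornerXn; congr (_ * _).
  by under eq_bigr do rewrite -exprM mulnC; rewrite prodrXr.
apply/mpolyP => m; rewrite mcoeff0; have [m_p|] := boolP (m \in msupp p); last first.
  by rewrite -mcoeff_eq0 => /eqP.
have := congr1 (fun q : {poly F} => q`_(w m)) q0; rewrite coef_sum coef0.
rewrite (bigD1_seq m) //= coefZ coefXn eqxx mulr1 big1_seq ?addr0 //= => m' /andP[m'm m'_p].
rewrite coefZ coefXn; case: eqP => [/esym E|]; last by rewrite mulr0.
case/eqP: m'm; apply/mnmP; exact: base_expansion_inj (digit m' m'_p) (digit m m_p) E.
Qed.

(** Since [msize] is the degree plus one, [b] bounds the total degree. *)
Definition polyfun D (b : nat) (f : 'rV[F]_D -> F) : Prop :=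
  exists2 p : {mpoly F[D]}, (msize p <= b.+1)%N & forall x, f x = p.@[fun i => x 0 i].

Section Closure.
Variable D : nat.
Implicit Types f g : 'rV[F]_D -> F.

Lemma polyfunW b c f : (b <= c)%N -> polyfun b f -> polyfun c f.
Proof. by move=> bc [p sp fE]; exists p => //; apply: leq_trans sp _. Qed.

Lemma eq_polyfun b f g : f =1 g -> polyfun b f -> polyfun b g.
Proof. by move=> fg [p sp fE]; exists p => // x; rewrite -fg. Qed.

Lemma polyfunC b (c : F) : polyfun b (fun _ : 'rV[F]_D => c).
Proof.
exists c%:MP; last by move=> x; rewrite mevalC.
by rewrite msizeC; case: eqP.
Qed.

Lemma polyfun_coord i : polyfun 1 (fun x : 'rV[F]_D => x 0 i).
Proof. by exists 'X_i => [|x]; rewrite ?msizeX ?mdeg1 ?mevalXU. Qed.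

Lemma polyfunD b f g : polyfun b f -> polyfun b g -> polyfun b (fun x => f x + g x).
Proof.
move=> [p sp fE] [q sq gE]; exists (p + q) => [|x]; last by rewrite mevalD fE gE.
by apply: leq_trans (msizeD_le _ _) _; rewrite geq_max sp.
Qed.

Lemma polyfunM b c f g :
  polyfun b f -> polyfun c g -> polyfun (b + c) (fun x => f x * g x).
Proof.
move=> [p sp fE] [q sq gE]; exists (p * q) => [|x]; last by rewrite mevalM fE gE.
have [->|p0] := eqVneq p 0; first by rewrite mul0r msize0.
have [->|q0] := eqVneq q 0; first by rewrite mulr0 msize0.
by rewrite msizeM //; move: (msize p) (msize q) sp sq => u v; lia.
Qed.

Lemma polyfun_sum (I : Type) (s : seq I) b (f : I -> 'rV[F]_D -> F) :
  (forall i, polyfun b (f i)) -> polyfun b (fun x => \sum_(i <- s) f i x).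
Proof.
move=> fP; elim: s => [|i s IH].
  by apply: eq_polyfun (polyfunC b 0) => x; rewrite big_nil.
by apply: eq_polyfun (polyfunD (fP i) IH) => x; rewrite big_cons.
Qed.

Lemma polyfun_prod (I : Type) (s : seq I) (b : I -> nat) (f : I -> 'rV[F]_D -> F) :
  (forall i, polyfun (b i) (f i)) ->
  polyfun (\sum_(i <- s) b i) (fun x => \prod_(i <- s) f i x).
Proof.
move=> fP; elim: s => [|i s IH].
  by apply: eq_polyfun (polyfunC _ 1) => x; rewrite big_nil.
by rewrite big_cons; apply: eq_polyfun (polyfunM (fP i) IH) => x; rewrite big_cons.
Qed.

Lemma polyfunX b k f : polyfun b f -> polyfun (k * b) (fun x => f x ^+ k).
Proof.
move=> fP; have := polyfun_prod (index_enum 'I_k) (fun=> fP).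
rewrite sum_nat_const card_ord; apply: eq_polyfun => x.
by rewrite prodr_const card_ord.
Qed.

Lemma polyfun_det b k (A : 'rV[F]_D -> 'M[F]_k) :
  (forall i j, polyfun b (fun x => A x i j)) -> polyfun (k * b) (fun x => \det (A x)).
Proof.
move=> AP; apply: polyfun_sum => s; rewrite -[(k * b)%N]add0n.
apply: polyfunM; first exact: polyfunC.
have := polyfun_prod (index_enum 'I_k) (fun i => AP i (s i)).
by rewrite sum_nat_const card_ord.
Qed.

Lemma polyfun_comp b c n (p : {mpoly F[n]}) (g : 'I_n -> 'rV[F]_D -> F) :
  (msize p <= b.+1)%N -> (forall i, polyfun c (g i)) ->
  polyfun (b * c) (fun x => p.@[fun i => g i x]).
Proof.
move=> sp gP; pose f m x := p@_m * \prod_i g i x ^+ (m i).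
suff fP m : m \in msupp p -> polyfun (b * c) (f m).
  (* [polyfun_sum] wants one bound for all indices, so terms off the support are replaced by
     zero. *)
  have fP' m : polyfun (b * c) (fun x => if m \in msupp p then f m x else 0).
    by case: (boolP (m \in msupp p)) => [/fP|_] //; apply: polyfunC.
  apply: eq_polyfun (polyfun_sum (msupp p) fP') => x.
  by rewrite mevalE [LHS]big_seq_cond [RHS]big_seq_cond; apply: eq_bigr => m /andP[-> _].
move=> /msize_mdeg_lt m_lt; rewrite /f.
have := polyfun_prod (index_enum 'I_n) (fun i => polyfunX (m i) (gP i)).
rewrite -big_distrl /= -mdegE => fP.
apply: (@polyfunW (0 + mdeg m * c)); last exact: polyfunM (polyfunC _ _) fP.
by rewrite add0n leq_mul2r -ltnS (leq_trans m_lt sp) orbT.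
Qed.

(** Polynomials form an integral domain and are determined by their values; this is the
    irreducibility of affine space. *)
Lemma polyfun_mul_eq0 b c f g : polyfun b f -> polyfun c g ->
  (forall x, f x * g x = 0) -> (forall x, f x = 0) \/ (forall x, g x = 0).
Proof.
move=> [p sp fE] [q sq gE] fg0.
have /eqP : p * q = 0.
  apply: mpoly_eval_eq0 => v; have := fg0 (\row_i v i); rewrite fE gE -mevalM.
  by move=> <-; apply: meval_eq => i; rewrite mxE.
by rewrite mulf_eq0 => /orP[] /eqP e; [left => x; rewrite fE e meval0 |
  right => x; rewrite gE e meval0].
Qed.

End Closure.

Lemma polyfun_linear D n (B : 'M[F]_(D, n)) j : polyfun 1 (fun x => (x *m B) 0 j).
Proof.
have P : polyfun 1 (fun x => \sum_k x 0 k * B k j).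
  by apply: polyfun_sum => k; apply: (@polyfunM _ 1 0); [apply: polyfun_coord | apply: polyfunC].
by apply: eq_polyfun P => x; rewrite mxE.
Qed.

Lemma polyfun_comp_linear D n b (B : 'M[F]_(D, n)) f :
  polyfun b f -> polyfun b (fun x => f (x *m B)).
Proof.
move=> [p sp fE]; rewrite -[b]muln1.
by apply: eq_polyfun (polyfun_comp sp (fun i => polyfun_linear B i)) => x; rewrite fE.
Qed.

End PolynomialFunctions.

(** * Chains and Hilbert functions *)

(** At [m = K * C ^ D] the two sides are [m.+1 ^ D] times [m.+1] and times [m]. *)
Lemma expn_not_linearly_bounded (K C D : nat) :
  ~ (forall m, m.+1 ^ D.+1 <= K * (m.+1 * C) ^ D)%N.
Proof.
move=> /(_ (K * C ^ D)%N); set m := (K * C ^ D)%N.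
by rewrite expnMn mulnCA -/m expnSr leq_pmul2l ?expn_gt0 // ltnn.
Qed.

Section Chains.
Variables (F : numFieldType) (N : nat).
Implicit Types (X Y Z : set 'rV[F]_N.+1) (f : {mpoly F[N.+1]}) (u v w : 'rV[F]_N.+1).

Local Notation "f @@ v" := (f.@[fun i => v 0 i]) (at level 10).

(** An equation that fails at [v] is multiplied by a coordinate nonzero at [v]. This makes the
    degree positive, so that the form also vanishes at the zero vector. *)
Lemma closedP Z v : proj_closed Z -> v != 0 -> ~ Z v ->
  exists f d, [/\ f \is d.+1.-homog, forall w, Z w -> f @@ w = 0 & f @@ v != 0].
Proof.
move=> [S [S_hom ->]] v0 /=; have [S0|] := pselect (forall f, S f -> f @@ v = 0).
  by move=> nZ; case: nZ; split.
move=> /existsNP[f /not_implyP[Sf /eqP fv]] _; have [d fd] := S_hom f Sf.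
have /rV0Pn[k vk] := v0; exists (f * 'X_k), d; split.
- by rewrite -[d.+1]addn1 dhomogM // dhomogX /= mdeg1.
- by move=> w [_ /(_ f Sf) fw]; rewrite mevalM fw mul0r.
- by rewrite mevalM mevalXU mulf_neq0.
Qed.

Lemma proj_closed_neq0 Z v : proj_closed Z -> Z v -> v != 0.
Proof. by move=> [S [_ ->]] []. Qed.

Definition zero_locus f : set 'rV[F]_N.+1 := [set v : 'rV[F]_N.+1 | v != 0 /\ f @@ v = 0]%classic.

Lemma zero_locus_closed f d : f \is d.-homog -> proj_closed (zero_locus f).
Proof.
move=> fd; exists [set f]%classic; split=> [_ ->|]; first by exists d.
by apply/seteqP; split=> v /= [v0 h]; split=> //; [move=> _ -> | exact: h].
Qed.

Lemma dhomog_sum (I : finType) d (c : I -> F) (p : I -> {mpoly F[N.+1]}) :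
  (forall i, p i \is d.-homog) -> \sum_i c i *: p i \is d.-homog.
Proof. by move=> pd; apply: rpred_sum => i _; apply: rpredZ. Qed.

Lemma eval_sum n (I : finType) (c : I -> F) (p : I -> {mpoly F[n]}) (v : 'I_n -> F) :
  (\sum_i c i *: p i).@[v] = \sum_i c i * (p i).@[v].
Proof. by rewrite raddf_sum; apply: eq_bigr => i _; rewrite /= mevalZ. Qed.

(* [indep_forms X d I] : the Hilbert function of [X] in degree [d] is at least #|I|. *)
Definition indep_forms X d (I : finType) := exists p : I -> {mpoly F[N.+1]},
  (forall i, p i \is d.-homog) /\
  forall c : I -> F, (forall v, X v -> \sum_i c i * (p i) @@ v = 0) -> forall i, c i = 0.

Lemma indep_formsS X Y d (I : finType) : (X `<=` Y)%classic ->
  indep_forms X d I -> indep_forms Y d I.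
Proof.
move=> XY [p [pd p_ind]]; exists p; split=> // c c0; apply: p_ind => v Xv.
by apply: c0; apply: XY.
Qed.

(* If a form [f] vanishes on [Z] and not on the irreducible set [Y], then [f] is not a zero
   divisor on [Y], so its multiples are independent of forms that are independent on [Z]. *)
Lemma indep_forms_sum Z Y f d e (I J : finType) :
    (forall v, Y v -> v != 0) -> irreducible_set Y -> (Z `<=` Y)%classic ->
    f \is e.-homog -> (forall v, Z v -> f @@ v = 0) -> (exists2 v, Y v & f @@ v != 0) ->
    indep_forms Z (d + e) I -> indep_forms Y d J ->
  indep_forms Y (d + e) (I + J)%type.
Proof.
move=> Y0 [_ Yirr] ZY fe fZ [w Yw fw] [p [pd p_ind]] [q [qd q_ind]].
exists (fun k => match k with inl i => p i | inr j => q j * f end); split.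
  by case=> [i|j]; [apply: pd | apply: dhomogM].
move=> c c0; have cl i : c (inl i) = 0.
  move: i; apply: p_ind => v Zv; rewrite -[RHS](c0 v (ZY v Zv)) big_sumType /=.
  by rewrite [X in _ + X]big1 ?addr0 // => j _; rewrite mevalM fZ // !mulr0.
suff cr j : c (inr j) = 0 by case.
move: j; apply: q_ind => v Yv; rewrite -eval_sum.
set g := \sum_j _; have g_hom : g \is d.-homog by apply: dhomog_sum.
have [||] := Yirr _ _ (zero_locus_closed fe) (zero_locus_closed g_hom).
- move=> u Yu; have := c0 u Yu; rewrite big_sumType /= big1 => [|i _]; last by rewrite cl mul0r.
  rewrite add0r; under eq_bigr => j _ do rewrite mevalM mulrA.
  rewrite -big_distrl /= -eval_sum => /eqP; rewrite mulf_eq0 => /orP[] /eqP ?.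
    by right; split => //; apply: Y0.
  by left; split => //; apply: Y0.
- by move=> /(_ w Yw)[_ /eqP]; rewrite (negPf fw).
- by move=> /(_ v Yv)[].
Qed.

(** For a form that vanishes on one set of the chain but not on the next, [indep_forms_sum] turns
    into Pascal's rule. So along multiples of some degree [E] the Hilbert function of the [i]-th set
    grows at least like a polynomial of degree [i]. *)
Lemma chain_indep_forms X e (Z : 'I_e.+1 -> set 'rV[F]_N.+1) :
    irreducible_chain X Z -> forall i : 'I_e.+1,
  exists2 E, (0 < E)%N & forall m,
    exists2 I : finType, indep_forms (Z i) (m * E) I & ('C(m + i, i) <= #|I|)%N.
Proof.
move=> [Z_irr Z_lt]; have Z0 i v : Z i v -> v != 0.
  by have [[W Wc ->] _] := Z_irr i; move=> [_] /(proj_closed_neq0 Wc).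
case=> i; elim: i => [|i IH] lt_i_e.
  exists 1%N => // m; exists unit; last by rewrite addn0 bin0 card_unit.
  have [_ [[v Zv] _]] := Z_irr (Ordinal lt_i_e).
  have /rV0Pn[k vk] := Z0 _ _ Zv.
  exists (fun=> 'X_k ^+ m); split=> [_|c c0 []].
    by rewrite mulnC dhomogMn // dhomogX /= mdeg1.
  have := c0 v Zv; rewrite (bigD1 tt) //= big1 => [|[]//].
  rewrite addr0 rmorphXn /= mevalXU => /eqP.
  by rewrite mulf_eq0 expf_eq0 (negPf vk) andbF orbF => /eqP.
have lt_i : (i < e.+1)%N by apply: ltnW.
have [E E_gt0 IHE] := IH lt_i; set Y := Z (Ordinal lt_i_e); set Y' := Z (Ordinal lt_i) in IHE.
have [Y'Y Y_neq] : (Y' `<` Y)%classic by apply: Z_lt.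
have [f [d [fd fY' [w Yw fw]]]] : exists f d, [/\ f \is d.+1.-homog,
    forall w, Y' w -> f @@ w = 0 & exists2 w, Y w & f @@ w != 0].
  have [w /not_implyP[Yw Y'w]] : exists w, ~ (Y w -> Y' w) by exact/existsNP.
  have [[W Wc Y'E] _] := Z_irr (Ordinal lt_i).
  have [[W' _ YE] _] := Z_irr (Ordinal lt_i_e).
  have [|f [d [fd fW fw]]] := closedP Wc (Z0 _ _ Yw).
    by move=> Ww; apply: Y'w; rewrite /Y' Y'E; split=> //; move: Yw; rewrite /Y YE => -[].
  exists f, d; split=> // [u Y'u|]; last by exists w.
  by apply: fW; move: Y'u; rewrite /Y' Y'E => -[].
(* The new unit of degree is that of [f ^+ E]. It is a multiple of the old unit [E], so the bound
   for [Y'] applies in every degree that occurs. *)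
exists (d.+1 * E)%N; [by rewrite muln_gt0 | move=> m].
elim: m => [|m [J J_ind J_card]].
  have [I I_ind I_card] := IHE 0%N; exists I.
    exact: indep_formsS Y'Y I_ind.
  by apply: leq_trans I_card; rewrite !binn.
have [I I_ind I_card] := IHE (m.+1 * d.+1)%N.
exists (I + J)%type.
  rewrite mulSn addnC; apply: indep_forms_sum (Z0 _) (Z_irr _).2 Y'Y _ _ _ _ J_ind.
  - exact: dhomogMn fd.
  - by move=> v Y'v; rewrite rmorphXn /= fY' // expr0n gtn_eqF.
  - by exists w => //; rewrite rmorphXn /= expf_neq0.
  - by rewrite addnC -mulSn mulnA.
rewrite card_sum addSn binS addnC leq_add //.
apply: leq_trans I_card; apply: leq_bin2l; rewrite -addSnnS leq_add2r leq_pmulr //.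
Qed.

(** Pulling back along [psi] gives polynomials of degree at most [d * b] in [D] variables, for which
    there are at most [(d * b).+1 ^ D] monomials. With more forms than monomials some combination
    pulls back to zero, hence vanishes on [X]. *)
Lemma indep_forms_le X D b d (psi : 'rV[F]_D -> 'rV[F]_N.+1) (I : finType) :
    (forall k, polyfun b (fun x => psi x 0 k)) ->
    (forall f, f \is d.-homog -> (forall x, f @@ (psi x) = 0) -> forall v, X v -> f @@ v = 0) ->
  indep_forms X d I -> (#|I| <= (d * b).+1 ^ D)%N.
Proof.
move=> psi_poly psi_dom [p [pd p_ind]].
have p_poly i : polyfun (d * b) (fun x => (p i) @@ (psi x)).
  apply: polyfun_comp => //; rewrite msizeE; apply/bigmax_leqP_seq => m m_p _.
  by rewrite (dhomog_mf (pd i)).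
have /choice[q /all_and2[q_size qE]] i : exists q : {mpoly F[D]},
    (msize q <= (d * b).+1)%N /\ forall x, (p i) @@ (psi x) = q @@ x.
  by have [q] := p_poly i; exists q.
pose J := 'X_{1..D < (d * b).+1}.
have expo_lt (m : J) i : (m i < (d * b).+1)%N.
  by apply: leq_ltn_trans (bmdeg m); rewrite mdegE (bigD1 i) //= leq_addr.
have cardJ : (#|{: J}| <= (d * b).+1 ^ D)%N.
  rewrite -[D in X in (_ <= X)%N]card_ord -[(d * b).+1 in X in (_ <= X)%N]card_ord -card_ffun.
  apply: (@leq_card _ _ (fun m : J => [ffun i => inord (m i) : 'I_(d * b).+1])).
  move=> m m' /ffunP mm'; apply/val_inj/mnmP => i; have := congr1 val (mm' i).
  by rewrite !ffunE /= !inordK.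
apply: leq_trans cardJ; rewrite leqNgt; apply/negP => JI.
pose A := \matrix_(i < #|I|, j < #|{: J}|) (q (enum_val i))@_(enum_val j : J).
have : ~~ row_free A.
  by rewrite -row_leq_rank -ltnNge; apply: leq_ltn_trans (rank_leq_col _) JI.
rewrite -kermx_eq0 => /rowV0Pn[u /sub_kermxP uA0 /rV0Pn[k /negP]]; apply.
rewrite -[k]enum_valK; move: (enum_val k) => {}k.
apply/eqP; move: k; apply: (p_ind (fun i => u 0 (enum_rank i))) => v Xv.
rewrite -eval_sum; apply: psi_dom v Xv; first exact: dhomog_sum.
move=> x; rewrite eval_sum; under eq_bigr do rewrite qE; rewrite -eval_sum.
suff -> : \sum_i u 0 (enum_rank i) *: q i = 0 by rewrite meval0.
apply/mpolyP => m; rewrite mcoeff0 raddf_sum /=.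
have [lt_m|ge_m] := ltnP (mdeg m) (d * b).+1; last first.
  apply: big1 => i _; rewrite mcoeffZ; apply/eqP; rewrite mulf_eq0 mcoeff_eq0.
  by rewrite msize_mdeg_ge ?orbT // (leq_trans (q_size i)).
have := congr1 (fun B : 'rV_ _ => B 0 (enum_rank (BMultinom lt_m : J))) uA0; rewrite !mxE => {}uA0.
rewrite -[RHS]uA0 [RHS](reindex_onto enum_rank enum_val) /= => [|i _]; last by rewrite enum_valK.
apply: eq_big => [i|i _]; first by rewrite enum_rankK eqxx.
by rewrite mcoeffZ mxE !enum_rankK.
Qed.

(** The top set of the chain has growth at least [m ^ e / e!] by [chain_indep_forms] and at most a
    constant times [m ^ D] by [indep_forms_le]. *)
Lemma chain_length_le X D b (psi : 'rV[F]_D -> 'rV[F]_N.+1) e (Z : 'I_e.+1 -> _) :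
    (forall k, polyfun b (fun x => psi x 0 k)) ->
    (forall f d, f \is d.-homog -> (forall x, f @@ (psi x) = 0) ->
       forall v, X v -> f @@ v = 0) ->
  irreducible_chain X Z -> (e <= D)%N.
Proof.
move=> psi_poly psi_dom Z_chain; rewrite leqNgt; apply/negP => De.
have [E _ ZE] := chain_indep_forms Z_chain ord_max.
apply: (@expn_not_linearly_bounded e`! (E * b).+1 D) => m.
have [I I_ind I_card] := ZE m.
have {}I_ind : indep_forms X (m * E) I.
  apply: indep_formsS I_ind; have [[W _ ->] _] := Z_chain.1 ord_max.
  by move=> v [].
have := indep_forms_le psi_poly (fun f => @psi_dom f (m * E)%N) I_ind.
move=> /(leq_trans I_card) /= bin_le.
apply: (@leq_trans (e`! * 'C(m + e, e))); last first.
  rewrite leq_mul2l; apply/orP; right; apply: leq_trans bin_le _.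
  by case: (D) => // D'; rewrite leq_exp2r //; lia.
rewrite mulnC bin_ffact; apply: (@leq_trans (m.+1 ^ e)); first by rewrite leq_pexp2l.
(* Each of the [e] factors of the falling factorial of [m + e] is at least [m.+1]. *)
elim: (e) => // k IH; rewrite addnS ffactSS expnS leq_mul // ltnS leq_addr //.
Qed.

End Chains.

(** * Images of polynomial maps *)

Section ParametrizedSets.
Variables (F : numFieldType) (N : nat).
Implicit Types (X Y Z : set 'rV[F]_N.+1) (f : {mpoly F[N.+1]}) (u v w : 'rV[F]_N.+1).

Local Notation "f @@ v" := (f.@[fun i => v 0 i]) (at level 10).

Definition linform (c : 'I_N.+1 -> F) : {mpoly F[N.+1]} := \sum_k c k *: 'X_k.

Lemma linform_homog c : linform c \is 1.-homog.
Proof. by apply: dhomog_sum => k; rewrite dhomogX /= mdeg1. Qed.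

Lemma eval_linform c v : linform c @@ v = \sum_k v 0 k * c k.
Proof. by rewrite eval_sum; apply: eq_bigr => k _; rewrite mevalXU mulrC. Qed.

Lemma dhomog1X (p : {mpoly F[N.+1]}) k : p \is 1.-homog -> p ^+ k \is k.-homog.
Proof. by move=> /(dhomogMn k); rewrite mul1n. Qed.

Lemma dhomog_prodX (I : finType) (p : I -> {mpoly F[N.+1]}) (a : I -> nat) :
  (forall i, p i \is 1.-homog) -> \prod_i p i ^+ a i \is (\sum_i a i).-homog.
Proof.
move=> p1; elim/big_rec2: _ => [|i q d _ q_hom]; first exact: dhomog1.
by rewrite dhomogM // dhomog1X.
Qed.

Definition image_set D (phi : 'rV[F]_D -> 'rV[F]_N.+1) : set 'rV[F]_N.+1 :=
  [set v | v != 0 /\ exists x, v = phi x]%classic.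

(** [T] is the differential of [phi] at the origin. Expanding along one line at a time keeps the
    remainder a polynomial in the single variable [t]. *)
Definition first_order D (phi : 'rV[F]_D -> 'rV[F]_N.+1) (phi0 : 'rV[F]_N.+1)
    (T : 'M[F]_(D, N.+1)) :=
  forall x : 'rV[F]_D, exists R : 'I_N.+1 -> {poly F}, forall t k,
    phi (t *: x) 0 k = phi0 0 k + t * (x *m T) 0 k + t ^+ 2 * (R k).[t].

Lemma first_order_comp D D' phi phi0 T (B : 'M[F]_(D', D)) :
  first_order phi phi0 T -> first_order (fun x => phi (x *m B)) phi0 (B *m T).
Proof.
move=> H x; have [R RE] := H (x *m B); exists R => t k.
by rewrite -scalemxAl RE mulmxA.
Qed.

(* Along a line through the origin, the monomial [L ^ a] in the coordinates [L] has
   order [|a|] and leading coefficient [x ^ a]; so products of the coordinates [L],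
   made homogeneous by powers of [l0], are independent. *)
Lemma first_order_indep_forms D (phi : 'rV[F]_D -> 'rV[F]_N.+1) phi0 T
    (l0 : 'cV[F]_N.+1) (L : 'M[F]_(N.+1, D)) m :
    first_order phi phi0 T ->
    phi0 *m l0 = 1%:M -> phi0 *m L = 0 -> T *m L = 1%:M ->
  indep_forms (image_set phi) (D * m) {ffun 'I_D -> 'I_m.+1}.
Proof.
move=> phi1 phi_l0 phi_L TL; pose I := {ffun 'I_D -> 'I_m.+1}.
pose deg (a : I) := (\sum_i a i)%N.
have deg_le a : (deg a <= D * m)%N.
  rewrite -[D in (D * m)%N]card_ord -sum_nat_const; apply: leq_sum => i _.
  by rewrite -ltnS.
pose l := linform (fun k => l0 k 0); pose ll i := linform (fun k => L k i).
exists (fun a => l ^+ (D * m - deg a) * \prod_i ll i ^+ a i); split=> [a|c c0].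
  rewrite -[(D * m)%N in X in _ \is X](subnK (deg_le a)) dhomogM //.
    by rewrite dhomog1X // linform_homog.
  by apply: dhomog_prodX => i; apply: linform_homog.
suff ck k a : (deg a < k)%N -> c a = 0 by move=> a; apply: (ck (deg a).+1).
elim: k a => // k IH a; rewrite ltnS leq_eqVlt => /orP[/eqP deg_a|/IH //].
(* By induction the relation starts in order [k]; [P] is its leading form, and its coefficients are
   the [c a] in question. *)
pose P := \sum_(a : I | deg a == k) c a *: 'X_[[multinom (a i : nat) | i < D]].
suff P0 : P = 0.
  have := congr1 (mcoeff [multinom (a i : nat) | i < D]) P0.
  rewrite mcoeff0 raddf_sum /= (bigD1 a) ?deg_a //= big1.
    by rewrite addr0 mcoeffZ mcoeffX eqxx mulr1.
  move=> b /andP[_ ba]; rewrite mcoeffZ mcoeffX; case: eqP => [/mnmP E|]; last by rewrite mulr0.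
  case/eqP: ba; apply/ffunP => i; apply: val_inj; have := E i.
  by rewrite !mnmE.
apply: mpoly_eval_eq0 => y; pose x := \row_i y i.
have [R RE] := phi1 x.
(* On the line through [x] the form [l] becomes [g], with value [1] at [0], and [ll i] becomes [t]
   times [G i], where [G i] has value [x 0 i] at [0]. *)
pose Phi k := (phi0 0 k)%:P + (x *m T) 0 k *: 'X + 'X^2 * R k.
pose g := \sum_k (l0 k 0) *: Phi k.
pose G i := (x 0 i)%:P + 'X * \sum_k L k i *: R k.
have gE t : g.[t] = l @@ (phi (t *: x)).
  rewrite eval_linform horner_sum; apply: eq_bigr => j _.
  by rewrite /Phi RE !hornerE mulrC; congr (_ * _); ring.
have g0 : g.[0] = 1.
  rewrite gE eval_linform scale0r; have := congr1 (fun A : 'M_1 => A 0 0) phi_l0.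
  rewrite !mxE => e; rewrite -[RHS]e; apply: eq_bigr => j _.
  by have := RE 0 j; rewrite scale0r => ->; rewrite expr0n !mul0r !addr0.
have GE t i : t * (G i).[t] = ll i @@ (phi (t *: x)).
  rewrite eval_linform /G !hornerE horner_sum mulrDr.
  have xE : x 0 i = \sum_j (x *m T) 0 j * L j i.
    have -> : \sum_j (x *m T) 0 j * L j i = (x *m T *m L) 0 i by rewrite !mxE.
    by rewrite -mulmxA TL mulmx1.
  have phiL : \sum_j phi0 0 j * L j i = 0.
    by have := congr1 (fun A : 'rV_D => A 0 i) phi_L; rewrite !mxE.
  transitivity (\sum_j phi0 0 j * L j i + t * (\sum_j (x *m T) 0 j * L j i)
      + t ^+ 2 * \sum_j L j i * (R j).[t]).
    rewrite phiL add0r -xE expr2 -mulrA; congr (_ + t * (t * _)).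
    by apply: eq_bigr => j _; rewrite hornerZ.
  rewrite 2!mulr_sumr -!big_split /=; apply: eq_bigr => j _.
  by rewrite RE; ring.
pose Q := \sum_a c a *: ('X^(deg a) * (g ^+ (D * m - deg a) * \prod_i G i ^+ a i)).
have Q0 : Q = 0.
  have g_neq0 : g != 0.
    by apply/eqP => g00; move: g0; rewrite g00 horner0 => /eqP; rewrite eq_sym oner_eq0.
  (* The relation [c0] holds only where [phi (t *: x)] is nonzero; the extra factor [g], which is
     zero wherever [phi] is, covers the remaining [t]. *)
  apply/eqP; rewrite -(mulIr_eq0 _ (mulIf g_neq0)); apply/eqP.
  apply: poly_eval_eq0 => t; rewrite hornerM gE.
  have [->|phi_neq0] := eqVneq (phi (t *: x)) 0.
    by rewrite eval_linform big1 ?mulr0 // => j _; rewrite mxE mul0r.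
  rewrite horner_sum (_ : \sum_a _ = 0) ?mul0r //.
  rewrite -[RHS](c0 (phi (t *: x))); last by split=> //; exists (t *: x).
  apply: eq_bigr => b _; rewrite hornerZ mevalM rmorphXn /= -gE rmorph_prod /=; congr (_ * _).
  rewrite !hornerM hornerXn horner_exp mulrCA; congr (_ * _).
  rewrite horner_prod /deg -prodrXr -big_split /=; apply: eq_bigr => i _.
  by rewrite rmorphXn /= -GE exprMn horner_exp.
(* [Q'] is the quotient of [Q] by the [k]-th power of the variable, and its value at [0] is [P] at
   [x]. *)
pose Q' := \sum_(a : I | (k <= deg a)%N)
  c a *: ('X^(deg a - k) * (g ^+ (D * m - deg a) * \prod_i G i ^+ a i)).
have Q'0 : Q' = 0.
  apply/eqP; have : 'X^k * Q' == 0.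
    rewrite -Q0 /Q (bigID (fun b => k <= deg b)%N) /= [X in _ == _ + X]big1 ?addr0 => [|b].
      rewrite mulr_sumr; apply/eqP; apply: eq_bigr => b kb.
      by rewrite -scalerAr mulrA -exprD subnKC.
    by rewrite -ltnNge => /IH ->; rewrite scale0r.
  by rewrite mulf_eq0 expf_eq0 polyX_eq0 andbF.
have := congr1 (horner^~ 0) Q'0; rewrite /= horner0 horner_sum.
rewrite (bigID (fun b => deg b == k)%N) /= [X in _ + X]big1 ?addr0 => [Q'k|b /andP[kb bk]].
  rewrite -[RHS]Q'k raddf_sum /=; apply: eq_big => [b|b /eqP bk].
    by case: eqP => [->|]; rewrite ?leqnn ?andbF.
  rewrite mevalZ mevalX hornerZ !hornerM hornerXn bk subnn expr0 mul1r; congr (_ * _).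
  rewrite horner_exp g0 expr1n mul1r horner_prod; apply: eq_bigr => i _.
  by rewrite horner_exp mnmE /G !hornerE mxE.
rewrite hornerZ hornerM hornerXn expr0n subn_eq0 leqNgt ltn_neqAle eq_sym bk kb /=.
by rewrite mul0r mulr0.
Qed.

(** The intersection of all closed sets containing [X] is cut out by one set of equations, namely
    all forms that vanish on [X]. *)
Lemma closure_closed X : (forall v, X v -> v != 0) -> proj_closed (zariski_closure X).
Proof.
move=> X0; exists [set f | (exists d, f \is d.-homog) /\ forall v, X v -> f @@ v = 0]%classic.
split=> [f []//|]; apply/seteqP; split=> v /=.
  move=> Xv; split=> [|f [[d fd] fX]].
    apply: (Xv [set u | u != 0]%classic); last exact: X0.
    by exists set0; split=> //; apply/seteqP; split=> u //= [].
  have [] := Xv (zero_locus f); [exact: zero_locus_closed fd | | by []].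
  by move=> u Xu; split; [apply: X0 | apply: fX].
move=> [v0 vX] Z Zc XZ; have [//|nZv] := pselect (Z v).
have [f [d [fd fZ /eqP[]]]] := closedP Zc v0 nZv.
by apply: vX; split; [exists d.+1 | move=> u /XZ; apply: fZ].
Qed.

Lemma subset_closure_zariski X : (X `<=` zariski_closure X)%classic.
Proof. by move=> v Xv Z _; apply. Qed.

Lemma zariski_closureS X Y : (X `<=` zariski_closure Y)%classic ->
  (zariski_closure X `<=` zariski_closure Y)%classic.
Proof. by move=> XY v Xv Z Zc YZ; apply: Xv => // u Xu; apply: (XY u). Qed.

(** Two forms, each nonzero somewhere on the image, pull back to nonzero polynomials, whose product
    is nonzero. *)
Lemma image_set_irreducible D b (phi : 'rV[F]_D -> 'rV[F]_N.+1) :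
    (forall k, polyfun b (fun x => phi x 0 k)) -> (image_set phi !=set0)%classic ->
  irreducible_set (zariski_closure (image_set phi)).
Proof.
move=> phi_poly [v Yv]; split; first by exists v; apply: subset_closure_zariski.
move=> Z1 Z2 Z1c Z2c YZ.
suff [YZ1|YZ2] : (image_set phi `<=` Z1 \/ image_set phi `<=` Z2)%classic.
- by left=> u; apply.
- by right=> u; apply.
apply: contrapT => /not_orP[/existsNP[u /not_implyP[Yu Z1u]] /existsNP[w /not_implyP[Yw Z2w]]].
have [[u0 [x uE]] [w0 [y wE]]] := (Yu, Yw).
have [f1 [d1 [f1d f1Z f1u]]] := closedP Z1c u0 Z1u.
have [f2 [d2 [f2d f2Z f2w]]] := closedP Z2c w0 Z2w.
have poly f d : f \is d.-homog -> polyfun (d * b) (fun x => f @@ (phi x)).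
  move=> fd; apply: polyfun_comp => //; rewrite msizeE; apply/bigmax_leqP_seq => m m_f _.
  by rewrite (dhomog_mf fd).
have [z|/(_ x)|/(_ y)] := polyfun_mul_eq0 (poly _ _ f1d) (poly _ _ f2d).
(* Where [phi] takes the value [0] there is no point of the image; there [f1] vanishes because its
   degree is positive. *)
- have [z0|z_neq0] := eqVneq (phi z) 0.
    rewrite z0 (_ : f1 @@ (0 : 'rV_N.+1) = 0) ?mul0r // mevalE big1_seq // => m /andP[_ m_f1].
    have : mdeg m != 0%N by rewrite (dhomog_mf f1d).
    rewrite mdegE sum_nat_eq0 => /forallPn[k] /=; rewrite (bigD1 k) //= mxE expr0n => /negPf ->.
    by rewrite mul0r mulr0.
  have [] : (Z1 `|` Z2)%classic (phi z).
  + by apply: YZ; apply: subset_closure_zariski; split=> //; exists z.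
  + by move=> /f1Z ->; rewrite mul0r.
  + by move=> /f2Z ->; rewrite mulr0.
- by rewrite -uE => /eqP; rewrite (negPf f1u).
- by rewrite -wE => /eqP; rewrite (negPf f2w).
Qed.

(* The closures of the images of a flag of coordinate subspaces are distinct, since
   their Hilbert functions have different growth. *)
Lemma parametrized_chain X D b (phi : 'rV[F]_D -> 'rV[F]_N.+1) phi0 T
    (l0 : 'cV[F]_N.+1) (L : 'M[F]_(N.+1, D)) :
    (forall k, polyfun b (fun x => phi x 0 k)) -> first_order phi phi0 T ->
    phi0 *m l0 = 1%:M -> phi0 *m L = 0 -> T *m L = 1%:M ->
    (image_set phi `<=` zariski_closure X)%classic ->
  exists Z : 'I_D.+1 -> _, irreducible_chain (zariski_closure X) Z.
Proof.
move=> phi_poly phi1 phi_l0 phi_L TL phiX.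
pose psi j (x : 'rV[F]_j) := phi (x *m pid_mx j).
pose Z j := zariski_closure (image_set (@psi j)).
have psi_poly j k : polyfun b (fun x => psi j x 0 k).
  have H := polyfun_comp_linear (pid_mx j : 'M_(j, D)) (phi_poly k). exact: H.
have psi0 j : psi j 0 = phi0.
  have [R RE] := phi1 0; apply/rowP => k; have := RE 0 k.
  by rewrite /psi scale0r expr0n /= mul0mx !mul0r !addr0 => <-; rewrite mul0mx.
have phi0_neq0 : phi0 != 0.
  apply/eqP => e; move/eqP: phi_l0; rewrite e mul0mx eq_sym.
  by move/eqP/matrixP/(_ 0 0)/eqP; rewrite !mxE oner_eq0.
have Z_sub i j : (i <= j)%N -> (j <= D)%N -> (Z i `<=` Z j)%classic.
  move=> ij jD; apply: zariski_closureS => v [v0 [x vE]]; apply: subset_closure_zariski.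
  split=> //; exists (x *m pid_mx i); rewrite vE /psi -mulmxA mul_pid_mx.
  by rewrite (minn_idPr _) // (minn_idPl ij).
have Z_lt j : (j < D)%N -> ~ (Z j.+1 `<=` Z j)%classic.
  (* An inclusion would give [Z j], parametrized by [j] variables, at least [m.+1 ^ j.+1]
     independent forms in degree [j.+1 * m]. *)
  move=> jD ZZ; apply: (@expn_not_linearly_bounded 1 (j.+1 * b).+1 j) => m.
  have T1 : (pid_mx j.+1 : 'M_(j.+1, D)) *m T *m (L *m (pid_mx j.+1 : 'M_(D, j.+1))) = 1%:M.
    rewrite mulmxA -(mulmxA _ T) TL mulmx1 mul_pid_mx minnn (minn_idPr jD).
    by rewrite pid_mx_1.
  have := first_order_indep_forms m (first_order_comp (pid_mx j.+1) phi1) phi_l0 _ T1.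
  rewrite mulmxA phi_L mul0mx => /(_ erefl) ind.
  have {}ind : indep_forms (Z j) (j.+1 * m) {ffun 'I_j.+1 -> 'I_m.+1}.
    apply: indep_formsS ind => v Yv; apply: ZZ; exact: subset_closure_zariski.
  have := indep_forms_le (psi_poly j) _ ind; rewrite card_ffun !card_ord mul1n => le.
  apply: leq_trans (le _) _.
    move=> f fd f0 v Zv; have [] := Zv _ (zero_locus_closed fd); last by [].
    by move=> u [u0 [x uE]]; split=> //; rewrite uE; apply: f0.
  by case: (j) => // j'; rewrite leq_exp2r //; nia.
exists (fun j => Z j); split=> [j|i j ij].
  have jD : (j <= D)%N by rewrite -ltnS.
  split; last by apply: image_set_irreducible (psi_poly j) _; exists phi0; split=> //; exists 0.
  exists (Z j); first by apply: closure_closed => v [].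
  apply/seteqP; split=> [v Zv|v []//]; split=> //.
  apply: zariski_closureS Zv => u [u0 [x uE]]; apply: phiX; split=> //.
  by exists (x *m pid_mx j).
split; first by apply: Z_sub; [apply: ltnW | rewrite -ltnS].
have iD : (i < D)%N by apply: leq_trans ij _; rewrite -ltnS.
move=> ZZ; apply: (Z_lt i iD) => v Zv; apply: ZZ.
by apply: Z_sub Zv => //; rewrite -ltnS.
Qed.

End ParametrizedSets.

(** * Dimension estimates *)

Section Dimension.
Variables (F : numFieldType) (N : nat).
Implicit Types (X : set 'rV[F]_N.+1).

(** The identity of the affine cone is the parametrization. The bound exceeds the true one by one,
    but only the existence of a longest chain is needed. *)
Lemma chain_length_le_ambient X e (Z : 'I_e.+1 -> _) :
  irreducible_chain X Z -> (e <= N.+1)%N.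
Proof.
apply: (@chain_length_le _ _ X N.+1 1 id) => [k|f d _ f0 v _]; last exact: f0.
exact: polyfun_coord.
Qed.

Lemma proj_dim_ge X e (Z : 'I_e.+1 -> _) : irreducible_chain X Z -> (e <= proj_dim X)%N.
Proof.
move=> Zc; pose P d := `[< exists Z : 'I_d.+1 -> _, irreducible_chain X Z >].
have exP : exists d, P d by exists e; apply/asboolP; exists Z.
have leP d : P d -> (d <= N.+1)%N by move=> /asboolP[Z']; apply: chain_length_le_ambient.
have [d /asboolP dP d_max] := ex_maxnP exP leP.
have dX : has_dim X d by split=> // e' Z' ?; apply: d_max; apply/asboolP; exists Z'.
have /= [_] := xgetPex 0%N (ex_intro (fun d => has_dim X d) d dX).
by move=> /(_ _ _ Zc).
Qed.

Lemma proj_dim_le X D :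
  (forall e (Z : 'I_e.+1 -> _), irreducible_chain X Z -> (e <= D)%N) -> (proj_dim X <= D)%N.
Proof.
move=> H; have [[d dX]|nX] := pselect (exists d, has_dim X d).
  have /= [[Z Zc] _] := xgetPex 0%N (ex_intro (fun d => has_dim X d) d dX).
  exact: H Zc.
by rewrite /proj_dim xgetPN // => d dX; apply: nX; exists d.
Qed.

(** [phi] maps to the affine cone, and [T] contains the radial direction [phi0]. A complement [W] of
    [phi0] in [T] loses one dimension and consists of directions that stay independent in projective
    space. *)
Lemma proj_dim_closure_ge X K b (phi : 'rV[F]_K -> 'rV[F]_N.+1) phi0 T :
    (forall k, polyfun b (fun x => phi x 0 k)) -> first_order phi phi0 T ->
    phi0 != 0 -> (phi0 <= T)%MS -> (image_set phi `<=` zariski_closure X)%classic ->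
  ((\rank T).-1 <= proj_dim (zariski_closure X))%N.
Proof.
move=> phi_poly phi1 phi0_neq0 phi0T phiX; pose W := (T :\: phi0)%MS.
have rW : \rank W = (\rank T).-1.
  have := mxrank_cap_compl T phi0; rewrite -/W (capmx_idPr phi0T) rank_rV phi0_neq0.
  by move=> <-.
have WT : (row_base W <= T)%MS by rewrite eq_row_base diffmxSl.
have [B BE] := submxP WT; pose A := col_mx phi0 (row_base W).
have /row_freeP[C] : row_free A.
  rewrite -row_leq_rank -(addsmxE phi0 (row_base W)).
  have T_gt0 : (0 < \rank T)%N.
    by apply: leq_trans (mxrankS phi0T); rewrite rank_rV phi0_neq0.
  apply: (@leq_trans (\rank T)); first by rewrite [X in (1 + X)%N]rW add1n prednK.
  apply: mxrankS.
  apply: submx_trans (_ : (T :&: phi0 + W <= _)%MS); first by rewrite addsmxC addsmx_diff_cap_eq.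
  rewrite addsmx_sub (submx_trans (capmxSr _ _)) ?addsmxSl //.
  by rewrite (submx_trans _ (addsmxSr _ _)) // eq_row_base.
(* The first column of the right inverse [C] serves as [l0], the remaining ones as [L]. *)
rewrite -[C]hsubmxK mul_col_mx !mul_mx_row -block_mxEv scalar_mx_block => /eq_block_mx[e1 e2 _ e4].
have BT : B *m T *m rsubmx C = 1%:M by rewrite -BE.
have phiB_poly k : polyfun b (fun x => phi (x *m B) 0 k).
  exact: (polyfun_comp_linear B (phi_poly k)).
have phiB_X : (image_set (fun x => phi (x *m B)) `<=` zariski_closure X)%classic.
  by move=> v [v0 [x vE]]; apply: phiX; split=> //; exists (x *m B).
have [Z] := parametrized_chain phiB_poly (first_order_comp B phi1) e1 e2 BT phiB_X.
by rewrite -rW => /proj_dim_ge.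
Qed.

End Dimension.

(** * The Plucker map *)

Definition set_row (R : Type) m n (a : 'I_m) (w : 'rV[R]_n) (M : 'M[R]_(m, n)) :=
  \matrix_(i, j) if i == a then w 0 j else M i j.

Lemma prod_first_order (F : fieldType) n (a b : 'I_n -> F) : exists R : {poly F}, forall t,
  \prod_i (a i + t * b i) =
    \prod_i a i + t * (\sum_i \prod_j (if j == i then b j else a j)) + t ^+ 2 * R.[t].
Proof.
elim: n a b => [|n IH] a b.
  by exists 0 => t; rewrite !big_ord0 horner0 !mulr0 !addr0.
have [R RE] := IH (fun i => a (lift ord0 i)) (fun i => b (lift ord0 i)).
pose S := \sum_i \prod_j (if j == i then b (lift ord0 j) else a (lift ord0 j)).
exists ((a ord0)%:P * R + (b ord0 * S)%:P + (b ord0)%:P * ('X * R)) => t.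
rewrite big_ord_recl RE [\prod_(i < n.+1) a i]big_ord_recl [\sum_(i < n.+1) _]big_ord_recl.
have -> : \prod_j (if j == ord0 then b j else a j) =
    b ord0 * \prod_(i < n) a (lift ord0 i).
  by rewrite big_ord_recl eqxx.
have -> : \sum_(i < n) \prod_j (if j == lift ord0 i then b j else a j) = a ord0 * S.
  rewrite mulr_sumr; apply: eq_bigr => i _; rewrite big_ord_recl; congr (_ * _).
rewrite -/S !(hornerD, hornerM, hornerC, hornerX) /=.
set P := \prod_(i < n) a _; set Q := S; set T := R.[t]; ring.
Qed.

Section Determinant.
Variable F : fieldType.

Lemma det_first_order n (A B : 'M[F]_n) : exists R : {poly F}, forall t,
  \det (A + t *: B) =
    \det A + t * (\sum_i \det (set_row i (row i B) A)) + t ^+ 2 * R.[t].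
Proof.
have /choice[R RE] (s : 'S_n) := prod_first_order (fun i => A i (s i)) (fun i => B i (s i)).
exists (\sum_(s : {perm 'I_n}) (-1) ^+ s *: R s) => t.
rewrite /determinant exchange_big /= !mulr_sumr.
rewrite horner_sum mulr_sumr -!big_split /=; apply: eq_bigr => s _.
rewrite -mulr_sumr hornerZ; under eq_bigr => i _ do rewrite !mxE; rewrite RE.
set S := \sum_i _; set S' := \sum_i _; have -> : S = S'.
  by apply: eq_bigr => i _; apply: eq_bigr => j _; rewrite !mxE; case: eqP => // ->.
by rewrite !mulrDr [X in _ + X + _]mulrCA [X in _ + X = _]mulrCA.
Qed.

Lemma det_set_row_linear n (A : 'M[F]_n) a c (u v : 'rV[F]_n) :
  \det (set_row a (c *: u + v) A) = c * \det (set_row a u A) + \det (set_row a v A).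
Proof.
rewrite -[\det (set_row a v A)]mul1r; apply: (@determinant_multilinear _ _ _ _ _ a).
- by rewrite scale1r; apply/rowP => j; rewrite !mxE eqxx.
- by apply/matrixP => i j; rewrite !mxE eq_sym eq_liftF.
- by apply/matrixP => i j; rewrite !mxE eq_sym eq_liftF.
Qed.

End Determinant.

Section Plucker.
Variables (F : fieldType) (r n : nat).
Implicit Types M : 'M[F]_(r.+1, n.+1).
Local Notation N := (plucker_dim r n).

Lemma colsub_set_row m (g : 'I_m -> 'I_n.+1) a w M :
  colsub g (set_row a w M) = set_row a (colsub g w) (colsub g M).
Proof. by apply/matrixP => i j; rewrite !mxE. Qed.

Lemma plucker_set_row_linear a c (u v : 'rV[F]_n.+1) M :
  plucker (set_row a (c *: u + v) M) =
    c *: plucker (set_row a u M) + plucker (set_row a v M).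
Proof.
apply/rowP => k; rewrite !mxE /plucker_coord !colsub_set_row -det_set_row_linear.
by congr (\det (set_row _ _ _)); apply/rowP => j; rewrite !mxE.
Qed.

Lemma plucker_set_row0 a M : plucker (set_row a 0 M) = 0.
Proof.
have := plucker_set_row_linear a 1 0 0 M; rewrite scale1r addr0 scale1r => /esym/eqP.
by rewrite -subr_eq0 addrK => /eqP.
Qed.

Lemma set_row_id a M : set_row a (row a M) M = M.
Proof. by apply/matrixP => i j; rewrite !mxE; case: eqP => // ->. Qed.

Lemma plucker_mul (L : 'M[F]_r.+1) M : plucker (L *m M) = \det L *: plucker M.
Proof.
apply/rowP => k; rewrite !mxE /plucker_coord -det_mulmx; congr (\det _).
by apply/matrixP => i j; rewrite !mxE; apply: eq_bigr => l _; rewrite !mxE.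
Qed.

(** A matrix of smaller rank gives no point of the Grassmannian but adds only the zero vector to a
    sum, so parametrizations need not avoid it. *)
Lemma plucker_not_row_free M : ~~ row_free M -> plucker M = 0.
Proof.
rewrite -kermx_eq0 => /rowV0Pn[u /sub_kermxP uM u0]; apply/rowP => k; rewrite !mxE.
apply/eqP/det0P; exists u => //; apply/rowP => j; rewrite !mxE.
have := congr1 (fun A : 'rV_n.+1 => A 0 (nth ord0 (enum (nth finset.set0
  (enum [set S : {set 'I_n.+1} | #|S| == r.+1]%SET) k)) j)) uM.
by rewrite !mxE => e; rewrite -[RHS]e; apply: eq_bigr => i _; rewrite !mxE.
Qed.

Lemma plucker_first_order M B : exists R : 'I_N.+1 -> {poly F}, forall t k,
  plucker (M + t *: B) 0 k = plucker M 0 k +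
    t * (\sum_a plucker (set_row a (row a B) M)) 0 k + t ^+ 2 * (R k).[t].
Proof.
have /choice[R RE] (k : 'I_N.+1) : exists R : {poly F}, forall t,
    plucker (M + t *: B) 0 k = plucker M 0 k +
      t * (\sum_a plucker (set_row a (row a B) M)) 0 k + t ^+ 2 * R.[t]; last by exists R.
pose g j := nth ord0 (enum (nth finset.set0
  (enum [set S : {set 'I_n.+1} | #|S| == r.+1]%SET) k)) (j : 'I_r.+1).
have [R RE] := det_first_order (colsub g M) (colsub g B); exists R => t.
have -> : plucker (M + t *: B) 0 k = \det (colsub g M + t *: colsub g B).
  by rewrite !mxE; congr (\det _); apply/matrixP => i j; rewrite !mxE.
rewrite RE summxE [plucker M 0 k]mxE; congr (_ + _ * _ + _).
apply: eq_bigr => a _; rewrite [RHS]mxE /plucker_coord colsub_set_row.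
by congr (\det (set_row _ _ _)); apply/rowP => j; rewrite !mxE.
Qed.

End Plucker.

Section PluckerPoly.
Variables (F : numFieldType) (r n : nat).

Lemma polyfun_plucker D b (M : 'rV[F]_D -> 'M[F]_(r.+1, n.+1)) :
  (forall i j, polyfun b (fun x => M x i j)) ->
  forall k, polyfun (r.+1 * b) (fun x => plucker (M x) 0 k).
Proof.
move=> M_poly k; pose g j := nth ord0 (enum (nth finset.set0
  (enum [set S : {set 'I_n.+1} | #|S| == r.+1]%SET) k)) (j : 'I_r.+1).
have P : polyfun (r.+1 * b) (fun x => \det (colsub g (M x))).
  apply: polyfun_det => i j; apply: eq_polyfun (M_poly i (g j)) => x.
  by rewrite mxE.
by apply: eq_polyfun P => x; rewrite mxE.
Qed.

End PluckerPoly.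

Lemma eval_homog_scale (F : fieldType) n (f : {mpoly F[n]}) d c (v : 'rV[F]_n) :
  f \is d.-homog -> f.@[fun i => (c *: v) 0 i] = c ^+ d * f.@[fun i => v 0 i].
Proof.
move=> fd; rewrite !mevalE mulr_sumr; apply: eq_big_seq => m m_f.
rewrite mulrCA; congr (_ * _); rewrite -(dhomog_mf fd m_f) /= mdegE -prodrXr -big_split /=.
by apply: eq_bigr => i _; rewrite mxE exprMn.
Qed.

Lemma vec_mxE (R : Type) m n (x : 'rV[R]_(m * n)) i j : vec_mx x i j = x 0 (mxvec_index i j).
Proof. by rewrite -{2}[x]vec_mxK mxvecE. Qed.

(* On the dense chart where the leading minor is invertible, a plane has a unique basis
   of the form [row_mx 1 A]. *)
Lemma grassmannian_dim_le (F : numFieldType) r d :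
  (proj_dim (grassmannian F r (r + d)) <= r.+1 * d)%N.
Proof.
apply: proj_dim_le => e Z Zc.
pose chart (x : 'rV[F]_(r.+1 * d)) : 'M[F]_(r.+1, (r + d).+1) :=
  row_mx (1%:M : 'M_r.+1) (vec_mx x).
apply: (@chain_length_le _ _ _ _ (r.+1 * 1) (fun x => plucker (chart x))) Zc.
  apply: polyfun_plucker => i j; rewrite /chart.
  have [k jE|k jE] := split_ordP (j : 'I_(r.+1 + d)).
    apply: eq_polyfun (polyfunC _ _ (i == k)%:R) => x.
    by rewrite jE (@row_mxEl _ _ r.+1 d) mxE.
  apply: eq_polyfun (polyfun_coord _ (mxvec_index i k)) => x.
  by rewrite jE (@row_mxEr _ _ r.+1 d) vec_mxE.
move=> f df f_hom f0 v [M _ ->].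
pose G (x : 'rV[F]_(r.+1 * (r + d).+1)) := f.@[fun i => plucker (vec_mx x) 0 i].
pose lead (x : 'rV[F]_(r.+1 * (r + d).+1)) := lsubmx (vec_mx x : 'M[F]_(r.+1, r.+1 + d)).
have entry i j : polyfun 1 (fun x => (vec_mx x : 'M[F]_(r.+1, (r + d).+1)) i j).
  by apply: eq_polyfun (polyfun_coord _ (mxvec_index i j)) => x; rewrite vec_mxE.
have G_poly : polyfun (df * (r.+1 * 1)) G.
  apply: polyfun_comp; last exact: polyfun_plucker.
  rewrite msizeE; apply/bigmax_leqP_seq => m m_f _; by rewrite (dhomog_mf f_hom).
have lead_poly : polyfun (r.+1 * 1) (fun x => \det (lead x)).
  apply: polyfun_det => i j; apply: eq_polyfun (entry i (lshift d j)) => x.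
  by rewrite /lead [RHS]mxE.
(* [G] times the leading minor vanishes identically, and this minor is [1] at the centre of the
   chart; hence [G] vanishes also at bases outside the chart. *)
have [x|/(_ (mxvec M))|] := polyfun_mul_eq0 G_poly lead_poly.
- have [->|det0] := eqVneq (\det (lead x)) 0; first by rewrite mulr0.
  have lead_unit : lead x \in unitmx by rewrite unitmxE unitfE.
  pose A := invmx (lead x) *m rsubmx (vec_mx x : 'M[F]_(r.+1, r.+1 + d)).
  have vec_x : (vec_mx x : 'M[F]_(r.+1, r.+1 + d)) = lead x *m row_mx 1%:M A.
    by rewrite mul_mx_row mulmx1 mulmxA mulmxV // mul1mx hsubmxK.
  have {}vec_x : vec_mx x = lead x *m chart (mxvec A) by rewrite /chart mxvecK.
  by rewrite /G vec_x plucker_mul (eval_homog_scale _ _ f_hom) f0 mulr0 mul0r.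
- by rewrite /G mxvecK.
- move=> /(_ (mxvec (chart 0))); rewrite /lead mxvecK /chart row_mxKl det1 => /eqP.
  by rewrite oner_eq0.
Qed.

(** * Terracini's lemma for Grassmannians *)

Section Terracini.
Variables (F : numFieldType) (r n h : nat).
Hypothesis n_ger : (r <= n)%N.
Variable M : 'I_h -> 'M[F]_(r.+1, n.+1).
Local Notation N := (plucker_dim r n).
Local Notation K := (h * (r.+1 * n.+1))%N.

Let mat i (x : 'rV[F]_K) : 'M[F]_(r.+1, n.+1) := vec_mx (row i (vec_mx x)).

(** The cone over the secant variety is parametrized near the sum of the [plucker (M i)]; a vector
    of length [K] collects the perturbations of all [h] matrices, and [dphi] is the differential at
    the origin. *)
Let phi x : 'rV[F]_N.+1 := \sum_i plucker (M i + mat i x).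

Let dphi x : 'rV[F]_N.+1 := \sum_i \sum_a plucker (set_row a (row a (mat i x)) (M i)).

Let dphi_linear : linear dphi.
Proof.
move=> c x y; rewrite /dphi scaler_sumr -big_split; apply: eq_bigr => i _.
rewrite scaler_sumr -big_split; apply: eq_bigr => a _ /=.
by rewrite -plucker_set_row_linear /mat; rewrite !linearP.
Qed.

HB.instance Definition _ := GRing.isLinear.Build _ _ _ _ dphi dphi_linear.

Definition tangent_span : 'M[F]_(K, N.+1) := lin1_mx dphi.

Lemma plucker_tangent i a w : (plucker (set_row a w (M i)) <= tangent_span)%MS.
Proof.
pose x : 'rV[F]_K := mxvec (\matrix_j if j == i then mxvec (set_row a w 0) else 0).
suff -> : plucker (set_row a w (M i)) = dphi x by rewrite -mul_rV_lin1 submxMl.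
have mat_x j : mat j x = if j == i then set_row a w 0 else 0.
  by rewrite /mat mxvecK rowK; case: eqP => // _; rewrite ?mxvecK ?linear0.
rewrite /dphi (bigD1 i) //= (bigD1 a) //= mat_x eqxx !big1 ?addr0.
- by congr (plucker (set_row _ _ _)); apply/rowP => j; rewrite !mxE eqxx.
- move=> j /negPf ji; rewrite big1 // => b _; rewrite mat_x ji.
  by rewrite linear0 plucker_set_row0.
- move=> b /negPf ba; rewrite -[RHS](plucker_set_row0 b (M i)).
  by congr (plucker (set_row _ _ _)); apply/rowP => j; rewrite !mxE ba.
Qed.

Lemma secant_dim_ge : \sum_i plucker (M i) != 0 ->
  ((\rank tangent_span).-1 <= proj_dim (secant h (grassmannian F r n)))%N.
Proof.
move=> sum_neq0; apply: (@proj_dim_closure_ge _ _ _ _ (r.+1 * 1) phi _ _ _ _ sum_neq0).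
- move=> k; have P : polyfun (r.+1 * 1) (fun x => \sum_i plucker (M i + mat i x) 0 k).
    apply: polyfun_sum => i; apply: polyfun_plucker => a b.
    have P := polyfunD (polyfunC _ 1 (M i a b))
      (polyfun_coord F (mxvec_index i (mxvec_index a b) : 'I_K)).
    by apply: eq_polyfun P => x; rewrite [RHS]mxE /mat vec_mxE [row _ _ _ _]mxE vec_mxE.
  by apply: eq_polyfun P => x; rewrite summxE.
- move=> x; have /choice[R RE] i := plucker_first_order (M i) (mat i x).
  exists (fun k => \sum_i R i k) => t k.
  have xT : x *m tangent_span = dphi x by rewrite mul_rV_lin1.
  rewrite xT !summxE horner_sum !mulr_sumr -!big_split /=; apply: eq_bigr => i _.
  by rewrite -RE /mat !linearZ.
- apply: summx_sub => i _; rewrite -[M i](set_row_id ord0).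
  exact: plucker_tangent.
move=> v [v0 [x vE]] Z _; apply; split=> //.
have base_free : row_free (pid_mx r.+1 : 'M[F]_(r.+1, n.+1)).
  by rewrite /row_free rank_pid_mx.
(* All [h] rows of the matrix in [secant] must lie on the Grassmannian, so a perturbed matrix of
   smaller rank is replaced by a fixed basis. *)
pose P i := if row_free (M i + mat i x) then plucker (M i + mat i x)
            else plucker (pid_mx r.+1 : 'M[F]_(r.+1, n.+1)).
exists (\matrix_i P i); split=> [i|].
  by rewrite rowK /P; case: ifP => M_free; [exists (M i + mat i x) | exists (pid_mx r.+1)].
rewrite vE; apply: summx_sub => i _; have [M_free|M_nfree] := boolP (row_free (M i + mat i x)).
  by apply: (eq_row_sub i); rewrite rowK /P M_free.
by rewrite plucker_not_row_free // sub0mx.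
Qed.

End Terracini.

(** The [P i] with [i] in [A] need only be independent modulo the unit vectors from [B], that is, in
    the coordinates outside [B]. *)
Lemma rank_ge_unit_vectors (F : fieldType) K m (T : 'M[F]_(K, m)) (B : {set 'I_m})
    (I : finType) (A : {set I}) (P : I -> 'rV[F]_m) :
    (forall k, k \in B -> ((delta_mx 0 k : 'rV_m) <= T)%MS) ->
    (forall i, i \in A -> (P i <= T)%MS) ->
    (forall u : I -> F, (forall i, i \notin A -> u i = 0) ->
       (forall k, k \notin B -> \sum_i u i * P i 0 k = 0) -> forall i, u i = 0) ->
  (#|B| + #|A| <= \rank T)%N.
Proof.
move=> BT AT P_ind.
pose E := \matrix_(j < #|B|) (delta_mx 0 (enum_val j) : 'rV[F]_m).
pose Q := \matrix_(j < #|A|) P (enum_val j).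
have EQT : (col_mx E Q <= T)%MS.
  rewrite -addsmxE addsmx_sub; apply/andP; split; apply/row_subP => j; rewrite rowK.
    by apply: BT; apply: enum_valP.
  by apply: AT; apply: enum_valP.
apply: leq_trans (mxrankS EQT); rewrite row_leq_rank -kermx_eq0; apply/rowV0P => w.
move=> /sub_kermxP; rewrite -[w]hsubmxK mul_row_col.
move: (lsubmx w) (rsubmx w) => w1 w2 {w} w0.
have w2E i : \sum_j w2 0 j * (enum_val j == i)%:R = 0.
  move: i; apply: (P_ind) => [i iA|k kB].
    apply: big1 => j _; case: eqP => [e|]; last by rewrite mulr0.
    by rewrite -e enum_valP in iA.
  have := congr1 (fun v : 'rV_m => v 0 k) w0; rewrite !mxE big1 => [|j _]; last first.
    rewrite !mxE /=; case: eqP => [e|]; last by rewrite mulr0.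
    by rewrite e enum_valP in kB.
  rewrite add0r => e; rewrite -[RHS]e; under eq_bigr do rewrite mulr_suml.
  rewrite exchange_big; apply: eq_bigr => j _; rewrite mxE (bigD1 (enum_val j)) //= eqxx mulr1.
  by rewrite big1 ?addr0 // => i /negPf ij; rewrite eq_sym ij mulr0 mul0r.
have w20 : w2 = 0.
  apply/rowP => j; rewrite mxE -[RHS](w2E (enum_val j)) (bigD1 j) //= eqxx mulr1 big1 ?addr0 //.
  by move=> i /negPf ij; rewrite (inj_eq enum_val_inj) ij mulr0.
rewrite w20 mul0mx addr0 in w0 *; apply/rowP => i; rewrite !mxE; case: splitP => j _.
  have := congr1 (fun v : 'rV_m => v 0 (enum_val j)) w0; rewrite !mxE (bigD1 j) //= big1.
    by rewrite !mxE !eqxx mulr1 addr0.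
  by move=> i' /negPf i'j; rewrite !mxE /= (inj_eq enum_val_inj) eq_sym i'j mulr0.
by rewrite mxE.
Qed.

(** An upper bound for the dimension of the Grassmannian suffices, because the expected dimension of
    the secant variety increases with it. *)
Lemma not_defective_of_rank (F : numFieldType) r n h (M : 'I_h -> 'M[F]_(r.+1, n.+1)) :
    (r <= n)%N -> \sum_i plucker (M i) != 0 ->
    (h * (r.+1 * (n - r)).+1 <= \rank (tangent_span M))%N ->
  ~ defective h (grassmannian F r n).
Proof.
move=> n_ger sum_neq0 rank_ge; rewrite /defective; apply/negP; rewrite -leqNgt.
apply: leq_trans (secant_dim_ge n_ger sum_neq0); apply: leq_trans (geq_minl _ _) _.
have := grassmannian_dim_le F r (n - r); rewrite subnKC // => dim_le.
rewrite subn1 -mulnSr; apply: leq_trans (_ : (h * (r.+1 * (n - r)).+1).-1 <= _)%N.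
  by rewrite -!subn1 leq_sub2r // leq_mul2l ltnS dim_le orbT.
by rewrite -!subn1 leq_sub2r.
Qed.

(** * Coordinate points *)

Section CoordinatePoints.
Variables (F : fieldType) (r n : nat).
Hypothesis n_ger : (r <= n)%N.
Local Notation N := (plucker_dim r n).
Implicit Types (g : 'I_r.+1 -> 'I_n.+1) (S J : {set 'I_n.+1}).

Definition index_set (k : 'I_N.+1) : {set 'I_n.+1} :=
  nth finset.set0 (enum [set S : {set 'I_n.+1} | #|S| == r.+1]%SET) k.

Lemma size_index_sets : size (enum [set S : {set 'I_n.+1} | #|S| == r.+1]%SET) = N.+1.
Proof. by rewrite -cardE card_draws card_ord prednK // bin_gt0. Qed.

Lemma card_index_set k : #|index_set k| = r.+1.
Proof.
have : index_set k \in enum [set S : {set 'I_n.+1} | #|S| == r.+1]%SET.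
  by rewrite mem_nth // size_index_sets.
by rewrite mem_enum inE => /eqP.
Qed.

Lemma index_set_inj : injective index_set.
Proof.
move=> k l /eqP; rewrite nth_uniq ?enum_uniq ?size_index_sets // => /eqP.
exact: val_inj.
Qed.

Lemma index_set_surj J : #|J| = r.+1 -> exists k, index_set k = J.
Proof.
move=> cJ; have JP : J \in enum [set S : {set 'I_n.+1} | #|S| == r.+1]%SET.
  by rewrite mem_enum inE cJ.
have lt : (index J (enum [set S : {set 'I_n.+1} | #|S| == r.+1]%SET) < N.+1)%N.
  by rewrite -size_index_sets index_mem.
by exists (Ordinal lt); rewrite /index_set nth_index.
Qed.

Lemma pluckerE (M : 'M[F]_(r.+1, n.+1)) k : plucker M 0 k = plucker_coord M (index_set k).
Proof. by rewrite mxE. Qed.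

(** [plucker_coord] takes the columns in increasing order and [g] in its own; the permutation
    between the two, hence the sign, is the same for all [M]. *)
Lemma plucker_coord_imset g : injective g -> exists s : 'S_r.+1,
  forall M : 'M[F]_(r.+1, n.+1), plucker_coord M (g @: finset.setT) = (-1) ^+ s * \det (colsub g M).
Proof.
move=> g_inj; set S := (g @: finset.setT)%SET; pose e (j : 'I_r.+1) := nth ord0 (enum S) j.
have size_S : size (enum S) = r.+1 by rewrite -cardE card_imset // cardsT card_ord.
have /choice[f fE] j : exists i, g i = e j.
  have : e j \in S by rewrite -mem_enum mem_nth // size_S.
  by case/imsetP => i _ ->; exists i.
have f_inj : injective f.
  move=> i j fij; have /eqP : e i = e j by rewrite -!fE fij.
  by rewrite nth_uniq ?enum_uniq ?size_S // => /eqP/val_inj.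
exists (perm f_inj) => M; rewrite /plucker_coord.
have -> : colsub (fun j : 'I_r.+1 => nth ord0 (enum S) j) M = col_perm (perm f_inj) (colsub g M).
  by apply/matrixP => i j; rewrite !mxE permE fE.
by rewrite col_permE det_mulmx det_perm odd_permV mulrC.
Qed.

Definition coord_mx g : 'M[F]_(r.+1, n.+1) := \matrix_(i, j) (g i == j)%:R.

Lemma plucker_coord_mx g k : injective g -> index_set k = (g @: finset.setT)%SET ->
  exists2 c, c != 0 & plucker (coord_mx g) = c *: delta_mx 0 k.
Proof.
move=> g_inj kE; have [s sE] := plucker_coord_imset g_inj.
exists ((-1) ^+ s); first by rewrite signr_eq0.
apply/rowP => l; rewrite pluckerE !mxE /=; have [->|lk] := eqVneq l k.
  rewrite kE sE; congr (_ * _); rewrite -[RHS](@det1 _ r.+1); congr (\det _).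
  by apply/matrixP => i j; rewrite !mxE (inj_eq g_inj).
(* For any other index set some row of [coord_mx g] has its only nonzero entry outside the chosen
   columns. *)
rewrite mulr0; have [i gi] : exists i, g i \notin index_set l.
  apply/existsP; apply: contraR lk; rewrite negb_exists => /forallP gl.
  apply/eqP/index_set_inj/esym; rewrite kE; apply/eqP; rewrite eqEcard.
  rewrite card_index_set card_imset // cardsT card_ord leqnn andbT.
  by apply/fintype.subsetP => _ /imsetP[i _ ->]; have := gl i; rewrite negbK.
apply/eqP/det0P; exists (delta_mx 0 i).
  by apply/rV0Pn; exists i; rewrite mxE !eqxx oner_eq0.
rewrite -rowE; apply/rowP => j; rewrite !mxE; case: eqP => // e; move: gi; rewrite e.
by rewrite -mem_enum mem_nth // -cardE card_index_set.
Qed.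

(** If the index set arises from the image of [g] by exchanging at most one element, replacing one
    row of [coord_mx g] by a unit vector gives its coordinate point up to sign. *)
Lemma coord_tangent K (T : 'M[F]_(K, N.+1)) g k : injective g ->
    (forall a w, (plucker (set_row a w (coord_mx g)) <= T)%MS) ->
    (#|(g @: finset.setT) :\: index_set k|%SET <= 1)%N -> ((delta_mx 0 k : 'rV_N.+1) <= T)%MS.
Proof.
move=> g_inj gT; set S := (g @: finset.setT)%SET; set J := index_set k => SJ.
have card_S : #|S| = r.+1 by rewrite card_imset // cardsT card_ord.
have [a [b [g'_inj g'J]]] : exists a b, injective (fun i => if i == a then b else g i) /\
    forall i, (if i == a then b else g i) \in J.
  have [/existsP[a gaJ]|/existsPn gJ] := boolP [exists a, g a \notin J].
    have [b bJ bS] : exists2 b, b \in J & b \notin S.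
      apply/subsetPn; apply: contra gaJ => JS.
      have /eqP -> : J == S by rewrite eqEcard JS card_S card_index_set /=.
      by rewrite imset_f.
    exists a, b; split=> [i j|i].
      have gb l : g l != b by apply: contraNneq bS => <-; rewrite imset_f.
      case: eqP => [->|_]; case: eqP => [->|_] //; last exact: g_inj.
        by move=> e; have := gb j; rewrite e eqxx.
      by move=> e; have := gb i; rewrite e eqxx.
    case: eqP => // /eqP ia; apply: contraNT ia => giJ; apply/eqP/g_inj.
    by apply: (card_le1_eqP SJ); rewrite !inE ?giJ ?gaJ imset_f.
  exists ord0, (g ord0).
  have gE i : (if i == ord0 then g ord0 else g i) = g i by case: eqP => // ->.
  by split=> [i j|i]; rewrite !gE; [apply: g_inj | have := gJ i; rewrite negbK].
have JE : J = ((fun i => if i == a then b else g i) @: finset.setT)%SET.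
  apply/esym/eqP; rewrite eqEcard card_index_set card_imset // cardsT card_ord leqnn andbT.
  by apply/fintype.subsetP => _ /imsetP[i _ ->].
have [c c0 cE] := plucker_coord_mx g'_inj JE.
rewrite -(eqmx_scale _ c0) -cE.
have -> : coord_mx (fun i => if i == a then b else g i) = set_row a (delta_mx 0 b) (coord_mx g).
  by apply/matrixP => i j; rewrite !mxE; case: (i == a); rewrite // eqxx /= eq_sym.
exact: gT.
Qed.

Definition ball S : {set 'I_N.+1} := [set k | #|S :\: index_set k| <= 1]%SET%N.

(** Besides [S] itself, the ball contains every exchange of one of the [r.+1] elements of [S] for
    one of the [n - r] others. *)
Lemma card_ball S : #|S| = r.+1 -> ((r.+1 * (n - r)).+1 <= #|ball S|)%N.
Proof.
move=> cS; pose swap (p : 'I_n.+1 * 'I_n.+1) := (p.2 |: (S :\ p.1))%SET.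
pose P := finset.setX S (~: S)%SET.
have PP p : p \in P -> (S :\: swap p = [set p.1])%SET /\ (swap p :\: S = [set p.2])%SET.
  case: p => x y; rewrite !inE /= => /andP[xS yS].
  split; apply/setP => z; rewrite !inE /=.
    by have [->|zx] := eqVneq z x; rewrite ?xS ?orbF ?andbT /=;
       [apply: contraNneq yS => <- | case: (z \in S); rewrite ?andbF ?orbT].
  by have [->|zy] := eqVneq z y; rewrite ?yS //= andbCA andNb andbF.
have swap_inj : {in P &, injective swap}.
  move=> p q /PP[p1 p2] /PP[q1 q2] pq; rewrite pq in p1 p2.
  have /set1_inj e1 : [set p.1]%SET = [set q.1]%SET by rewrite -p1 -q1.
  have /set1_inj e2 : [set p.2]%SET = [set q.2]%SET by rewrite -p2 -q2.
  by case: p q e1 e2 {pq p1 p2 q1 q2} => [? ?] [? ?] /= -> ->.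
have card_swap p : p \in P -> #|swap p| = r.+1.
  move=> pP; have [p1 p2] := PP p pP; have := cardsID S (swap p); rewrite p2 cards1.
  by have := cardsID (swap p) S; rewrite p1 cards1 finset.setIC cS => ->.
have <- : #|S |: (swap @: P)%SET|%SET = (r.+1 * (n - r)).+1.
  rewrite cardsU1 card_in_imset // cardsX cS cardsCs finset.setCK card_ord cS subSS.
  have -> : S \notin (swap @: P)%SET; last by rewrite add1n.
  apply/imsetP => -[p /PP[p1 _] e]; move: p1; rewrite -e finset.setDv => /eqP.
  by rewrite eq_sym -cards_eq0 cards1.
apply: leq_trans (leq_imset_card index_set _); apply: subset_leq_card.
apply/fintype.subsetP => J JP.
have cJ : #|J| = r.+1.
  by move: JP; rewrite !inE => /orP[/eqP ->//|/imsetP[p pP ->]]; apply: card_swap.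
have [k kJ] := index_set_surj cJ; apply/imsetP; exists k => //; rewrite inE kJ.
move: JP; rewrite !inE => /orP[/eqP ->|/imsetP[p pP ->]]; first by rewrite finset.setDv cards0.
by rewrite (PP p pP).1 cards1.
Qed.

(** Triangle inequality: for [J] in both balls, [S :\: S'] lies in the union of [S :\: J] and
    [J :\: S'], each with at most one element. *)
Lemma ball_disjoint S S' : #|S| = r.+1 -> #|S'| = r.+1 -> (3 <= #|S :\: S'|)%N ->
  [disjoint ball S & ball S'].
Proof.
move=> cS cS' SS'; rewrite -setI_eq0; apply/eqP/setP => k; rewrite !inE.
apply/negP => /andP[Sk S'k]; move: SS'; apply/negP; rewrite -ltnNge ltnS.
set J := index_set k in Sk S'k *.
have JS' : (#|J :\: S'| <= 1)%N.
  have := cardsID J S'; rewrite cS' -(card_index_set k) -/J -(cardsID S' J) finset.setIC.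
  by move=> /addnI <-.
apply: leq_trans (_ : #|(S :\: J) :|: (J :\: S')|%SET <= 2)%N.
  apply: subset_leq_card; apply/fintype.subsetP => x; rewrite !inE => /andP[xS' ->].
  by rewrite xS'; case: (x \in J).
by rewrite cardsU; lia.
Qed.

Lemma card_bigcup_ball m (S : 'I_m -> {set 'I_n.+1}) :
    (forall i, #|S i| = r.+1) -> (forall i j, i != j -> 3 <= #|S i :\: S j|)%N ->
  (m * (r.+1 * (n - r)).+1 <= #|\bigcup_i ball (S i)|%SET)%N.
Proof.
move=> cS dS; rewrite -sum1_card finset.partition_disjoint_bigcup => [|i j ij]; last first.
  exact: ball_disjoint (cS i) (cS j) (dS i j ij).
rewrite -[m in (m * _)%N]card_ord -sum_nat_const; apply: leq_sum => i _.
by rewrite sum1_card card_ball.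
Qed.

End CoordinatePoints.

Lemma not_defective_coord (F : numFieldType) r n h (g : 'I_h -> 'I_r.+1 -> 'I_n.+1) :
    (r <= n)%N -> (0 < h)%N -> (forall i, injective (g i)) ->
    (forall i j, i != j -> 3 <= #|(g i @: finset.setT) :\: (g j @: finset.setT)|%SET)%N ->
  ~ defective h (grassmannian F r n).
Proof.
move=> n_ger h_gt0 g_inj g_dist; pose S i := (g i @: finset.setT)%SET.
have cS i : #|S i| = r.+1 by rewrite card_imset // cardsT card_ord.
apply: (@not_defective_of_rank F r n h (fun i => coord_mx F (g i))) => //.
  pose o := Ordinal h_gt0.
  have [k kE] := index_set_surj n_ger (cS o).
  have [c c0 cE] := plucker_coord_mx F n_ger (g_inj o) kE.
  apply/rV0Pn; exists k; rewrite summxE (bigD1 o) //= big1 ?addr0.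
    by rewrite cE !mxE !eqxx mulr1.
  move=> i io; have [l lE] := index_set_surj n_ger (cS i).
  have [c' _ ->] := plucker_coord_mx F n_ger (g_inj i) lE.
  rewrite !mxE /=; case: eqP => [kl|]; last by rewrite mulr0.
  by have := g_dist i o io; rewrite -/(S i) -/(S o) -lE -kE kl finset.setDv cards0.
set T := tangent_span _.
have TP i a w : (plucker (set_row a w (coord_mx F (g i))) <= T)%MS by apply: plucker_tangent.
(* The unit vectors from the disjoint balls already suffice, so the family of further vectors is
   empty. *)
have := @rank_ge_unit_vectors _ _ _ T (\bigcup_i ball r (S i))%SET 'I_0 finset.set0 (fun=> 0).
rewrite cards0 addn0 => rk; apply: leq_trans (rk _ _ _); first exact: card_bigcup_ball.
- by move=> k /bigcupP[i _]; rewrite inE; apply: coord_tangent => //; apply: TP.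
- by move=> [].
- by move=> u _ _ [].
Qed.

Lemma not_defective_coord_family (F : numFieldType) r n h (I : finType)
    (g : I -> 'I_r.+1 -> 'I_n.+1) :
    (r <= n)%N -> (0 < h <= #|I|)%N -> (forall x, injective (g x)) ->
    (forall x y, x != y ->
       3 <= #|(g x @: finset.setT) :\: (g y @: finset.setT)|%SET)%N ->
  ~ defective h (grassmannian F r n).
Proof.
move=> n_ger /andP[h_gt0 h_le] g_inj g_dist.
apply: (@not_defective_coord F r n h (fun i => g (enum_val (widen_ord h_le i)))) => //.
move=> i j ij; apply: g_dist; apply: contraNneq ij => /enum_val_inj /(congr1 val) /= e.
exact/eqP/val_inj.
Qed.

(** * Codes of minimum distance three *)

Section Codes.
Variable q : nat.
Local Notation word := (nat -> 'I_q.+1).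

(** Words are functions on all of [nat] of which only the first [L] values count, so codes lengthen
    without casts. *)
Definition differ3 (L : nat) (u v : word) := exists i j k,
  [/\ (i < j < k)%N, (k < L)%N, u i != v i, u j != v j & u k != v k].

Definition is_code (L : nat) (I : finType) (w : I -> word) :=
  forall x y, x != y -> differ3 L (w x) (w y).

Definition has_code (L K : nat) := exists2 I : finType, #|I| = K & exists w, @is_code L I w.

Lemma has_codeW L L' K : (L <= L')%N -> has_code L K -> has_code L' K.
Proof.
move=> LL' [I IK [w wP]]; exists I => //; exists w => x y /wP[i [j [k [ijk kL *]]]].
by exists i, j, k; split=> //; apply: leq_trans kL LL'.
Qed.

Lemma has_code_unit : has_code 0 1.
Proof. by exists unit; [rewrite card_unit | exists (fun _ _ => ord0) => -[] []]. Qed.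

(** A new letter is appended three times: words with different beginnings already differ enough, and
    the others differ in all three new places. *)
Lemma has_code_repeat L K : has_code L K -> has_code (L + 3) (K * q.+1).
Proof.
move=> [I IK [w wP]]; exists (I * 'I_q.+1)%type; first by rewrite card_prod card_ord IK.
exists (fun x i => if (i < L)%N then w x.1 i else x.2) => -[x a] [y b] /=.
have [<-|xy _] := eqVneq x y.
  rewrite xpair_eqE eqxx /= => ab; exists L, L.+1, L.+2.
  have [-> ->] : (L.+1 < L)%N = false /\ (L.+2 < L)%N = false by lia.
  by rewrite ltnn; split=> //; lia.
have [i [j [k [ijk kL ? ? ?]]]] := wP x y xy; exists i, j, k.
have [iL jL] : (i < L)%N /\ (j < L)%N by lia.
by rewrite iL jL kL; split=> //; lia.
Qed.

Lemma has_code_repeats L K k : has_code L K -> has_code (L + 3 * k) (K * q.+1 ^ k).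
Proof.
move=> code0; elim: k => [|k IH]; first by rewrite muln0 addn0 muln1.
by rewrite mulnS [(3 + _)%N]addnC addnA expnSr mulnA; apply: has_code_repeat.
Qed.

Lemma has_code5 : has_code 5 (q.+1 ^ 2).
Proof.
exists ('I_q.+1 * 'I_q.+1)%type; first by rewrite card_prod card_ord -mulnn.
exists (fun x => nth 0 [:: x.1; x.2; x.1 + x.2; x.2; x.1]) => -[x y] [x' y'] /=.
have [<-|xx'] := eqVneq x x'.
  rewrite xpair_eqE eqxx /= => yy'; exists 1%N, 2%N, 3%N.
  by split=> //=; rewrite (inj_eq (addrI _)).
have [<- _|yy' _] := eqVneq y y'.
  by exists 0%N, 2%N, 4%N; split=> //=; rewrite (inj_eq (addIr _)).
by exists 0%N, 1%N, 3%N.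
Qed.

(** Addition is modulo [q.+1]. One changed letter shows in its own place and in two sums; two
    changed letters show in their own places and in a sum with the unchanged third. *)
Lemma has_code6 : has_code 6 (q.+1 ^ 3).
Proof.
exists ('I_q.+1 * 'I_q.+1 * 'I_q.+1)%type; first by rewrite !card_prod card_ord !expnSr mul1n.
pose w (x y z : 'I_q.+1) := nth 0 [:: x; y; z; x + y; y + z; x + z].
exists (fun x => w x.1.1 x.1.2 x.2) => -[[x y] z] [[x' y'] z']; rewrite !xpair_eqE /=.
have [<-|xx'] := eqVneq x x'; have [<-|yy'] := eqVneq y y'; have [<-|zz'] := eqVneq z z' => //= _.
- by exists 2%N, 4%N, 5%N; split=> //=; rewrite (inj_eq (addrI _)).
- by exists 1%N, 3%N, 4%N; split=> //=; rewrite ?(inj_eq (addrI _)) ?(inj_eq (addIr _)).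
- by exists 1%N, 2%N, 3%N; split=> //=; rewrite (inj_eq (addrI _)).
- by exists 0%N, 3%N, 5%N; split=> //=; rewrite (inj_eq (addIr _)).
- by exists 0%N, 2%N, 3%N; split=> //=; rewrite (inj_eq (addIr _)).
- by exists 0%N, 1%N, 4%N; split=> //=; rewrite (inj_eq (addIr _)).
- by exists 0%N, 1%N, 2%N.
Qed.

End Codes.

(* The first [(r + 1) * (q + 1)] basis vectors are split into [r + 1] blocks of size [q + 1],
   and a word picks one vector in each block. *)
Section Blocks.
Variables (r n q : nat).
Hypothesis qn : (r.+1 * q.+1 <= n.+1)%N.

Definition block_elt (i c : nat) : 'I_n.+1 := inord (i * q.+1 + c).

Lemma val_block_elt i c : (i < r.+1)%N -> (c < q.+1)%N -> block_elt i c = (i * q.+1 + c)%N :> nat.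
Proof. by move=> ir cq; rewrite inordK //; nia. Qed.

Lemma block_elt_inj i j c d : (i < r.+1)%N -> (j < r.+1)%N -> (c < q.+1)%N -> (d < q.+1)%N ->
  block_elt i c = block_elt j d -> i = j /\ c = d.
Proof.
move=> ir jr cq dq /(congr1 val); rewrite /= !val_block_elt // => e.
have := congr1 (divn^~ q.+1) e; have := congr1 (modn^~ q.+1) e.
by rewrite /= !divnMDl // !modnMDl !divn_small // !modn_small // !addn0.
Qed.

Definition word_pts (w : nat -> 'I_q.+1) (i : 'I_r.+1) := block_elt i (w i).

Lemma word_pts_inj w : injective (word_pts w).
Proof. by move=> i j /block_elt_inj[] // /val_inj. Qed.

Lemma word_pts_dist u w : differ3 r.+1 u w ->
  (3 <= #|(word_pts u @: finset.setT) :\: (word_pts w @: finset.setT)|%SET)%N.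
Proof.
move=> [i [j [k [/andP[ij jk] kr ui uj uk]]]].
have [ir jr] : (i < r.+1)%N /\ (j < r.+1)%N by lia.
apply/card_geqP; exists (map (word_pts u) [:: Ordinal ir; Ordinal jr; Ordinal kr]).
split=> //.
  rewrite (map_inj_uniq (@word_pts_inj u)).
  by rewrite /= !inE -!val_eqE /=; lia.
have out (l : 'I_r.+1) : u l != w l ->
    word_pts u l \in ((word_pts u @: finset.setT) :\: (word_pts w @: finset.setT))%SET.
  move=> ul; rewrite !inE imset_f // andbT; apply/imsetP => -[l' _ /block_elt_inj[] //].
  by move=> /val_inj <- /val_inj e; rewrite e eqxx in ul.
by move=> x; rewrite /= !in_cons in_nil orbF => /or3P[] /eqP ->; apply: out.
Qed.

Definition block_pts (i : 'I_r.+1) := block_elt 0 i.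

Lemma block_pts_inj : (r <= q)%N -> injective block_pts.
Proof.
move=> rq i j e; have lt (k : 'I_r.+1) : (k < q.+1)%N by apply: leq_trans (ltn_ord k) _.
by have [_ /val_inj] := block_elt_inj (ltn0Sn r) (ltn0Sn r) (lt i) (lt j) e.
Qed.

Lemma block_word_pts w : (r <= q)%N ->
  (#|(block_pts @: finset.setT) :&: (word_pts w @: finset.setT)|%SET <= 1)%N.
Proof.
move=> rq; rewrite -(cards1 (word_pts w ord0)); apply: subset_leq_card.
apply/fintype.subsetP => x; rewrite !inE => /andP[/imsetP[i _ ->] /imsetP[j _ e]].
rewrite e; apply/eqP; congr word_pts; apply: val_inj.
have iq : (i < q.+1)%N by apply: leq_trans (ltn_ord i) _.
by have [] := block_elt_inj (ltn0Sn r) (ltn_ord j) iq (ltn_ord _) e.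
Qed.

Lemma not_defective_code (F : numFieldType) h K :
  (r <= n)%N -> has_code q r.+1 K -> (0 < h <= K)%N -> ~ defective h (grassmannian F r n).
Proof.
move=> n_ger [I <- [w wP]] hI.
apply: (@not_defective_coord_family F r n h I (fun x => word_pts (w x))) => // [x|x y xy].
  exact: word_pts_inj.
exact/word_pts_dist/wP.
Qed.

(** The set inside the first block has [r.+1] elements and shares at most one with any word, so it
    differs from it in at least [r >= 3] elements. *)
Lemma not_defective_code_block (F : numFieldType) h K : (3 <= r)%N -> (r <= q)%N ->
  (r <= n)%N -> has_code q r.+1 K -> (0 < h <= K.+1)%N -> ~ defective h (grassmannian F r n).
Proof.
move=> r_ge3 rq n_ger [I <- [w wP]] hI.
pose g o := if o is Some x then word_pts (w x) else block_pts.
have g_inj o : injective (g o) by case: o => [x|]; [apply: word_pts_inj | apply: block_pts_inj].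
apply: (@not_defective_coord_family F r n h (option I) g) => //; first by rewrite card_option.
have card_g o : #|(g o @: finset.setT)%SET| = r.+1 by rewrite card_imset // cardsT card_ord.
case=> [x|] [y|] // xy.
- exact/word_pts_dist/wP.
- rewrite cardsD card_g finset.setIC; have := block_word_pts (w x) rq.
  by rewrite /=; set c := #|_|; lia.
- rewrite cardsD card_g; have := block_word_pts (w y) rq.
  by rewrite /=; set c := #|_|; lia.
Qed.

End Blocks.

(** * An additional point for planes *)

Lemma det_mx33 (F : comNzRingType) (f : nat -> nat -> F) : \det (\matrix_(i < 3, j < 3) f i j) =
  f 0 0 * (f 1 1 * f 2 2 - f 1 2 * f 2 1) - f 0 1 * (f 1 0 * f 2 2 - f 1 2 * f 2 0)
  + f 0 2 * (f 1 0 * f 2 1 - f 1 1 * f 2 0).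
Proof.
rewrite (expand_det_row _ ord0) !big_ord_recl big_ord0 /cofactor.
rewrite !(expand_det_row _ ord0) !big_ord_recl !big_ord0 /cofactor !det_mx11 !mxE /=.
by rewrite /bump /=; ring.
Qed.

Lemma plucker_set_row_sum (F : fieldType) r n a (w : 'rV[F]_n.+1) (M : 'M[F]_(r.+1, n.+1)) :
  plucker (set_row a w M) = \sum_b w 0 b *: plucker (set_row a (delta_mx 0 b) M).
Proof.
rewrite [in LHS](row_sum_delta w); elim: (index_enum _) => [|b s IH].
  by rewrite !big_nil plucker_set_row0.
by rewrite !big_cons plucker_set_row_linear IH.
Qed.

(* With [a_c], [b_c], [c_c] the elements number [c] of the three blocks, the coordinate points
   [a_c ^ b_c ^ c_c] are supplemented by
   [(a_0 + .. + a_3) ^ (b_0 + .. + b_3) ^ (c_0 + .. + c_3)]. *)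
Section ExtraPoint.
Variables (F : numFieldType) (n q : nat).
Hypothesis q_ge3 : (3 <= q)%N.
Hypothesis qn : (3 * q.+1 <= n.+1)%N.
Local Notation N := (plucker_dim 2 n).
Local Notation e := (block_elt n q).
Local Notation S c := (word_pts n (fun=> c) @: [set: 'I_3])%SET.

Let n_ge2 : (2 <= n)%N. Proof. by lia. Qed.

(** Four elements per block are used because comparing positions [c] and [0] in [diag0] requires two
    further distinct positions. *)
Definition extra_entry (i p : nat) : F := ((p %/ q.+1 == i) && (p %% q.+1 < 4))%N%:R.

Definition extra_mx : 'M[F]_(3, n.+1) := \matrix_(i, p) extra_entry i p.

Lemma extra_entry_block i l c : (l < 3)%N -> (c < 4)%N -> extra_entry i (e l c) = (l == i)%:R.
Proof.
move=> l3 c4; have cq : (c < q.+1)%N by apply: leq_trans c4 _.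
rewrite /extra_entry (val_block_elt qn) // divnMDl // modnMDl divn_small // modn_small //.
by rewrite addn0 c4 andbT.
Qed.

(** A pairwise separated triple meets each coordinate set in at most one element. Its coordinate is
    then zero on all tangent spaces at the coordinate points and tests the extra point alone. *)
Definition separated (p p' : 'I_n.+1) : bool :=
  (p != p') && ~~ [&& p < 3 * q.+1, p' < 3 * q.+1 & p %% q.+1 == p' %% q.+1]%N.

Lemma separatedC p p' : separated p p' = separated p' p.
Proof. by rewrite /separated eq_sym andbCA [(_ %% _)%N == _]eq_sym. Qed.

Lemma separated_block l l' c c' : (l < 3)%N -> (l' < 3)%N -> (c < 4)%N -> (c' < 4)%N -> c != c' ->
  separated (e l c) (e l' c').
Proof.
move=> l3 l'3 c4 c'4 cc'; have [cq c'q] : (c < q.+1)%N /\ (c' < q.+1)%N by lia.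
apply/andP; split; first by apply: contraNneq cc' => /(block_elt_inj qn)[] // _ ->.
by rewrite !(val_block_elt qn) // !modnMDl !modn_small // (negPf cc') !andbF.
Qed.

Lemma separated_inactive (p : 'I_n.+1) l c : ~~ ((p < 3 * q.+1) && (p %% q.+1 < 4))%N ->
  (l < 3)%N -> (c < 4)%N -> separated p (e l c).
Proof.
move=> p_in l3 c4; have cq : (c < q.+1)%N by lia.
have c_val : e l c = (l * q.+1 + c)%N :> nat by rewrite (val_block_elt qn).
have c_mod : (e l c %% q.+1 = c)%N by rewrite c_val modnMDl modn_small.
have c_lt : (e l c < 3 * q.+1)%N by rewrite c_val; nia.
apply/andP; split; first by apply: contraNneq p_in => ->; rewrite c_lt c_mod.
by apply: contra p_in => /and3P[-> _ /eqP ->]; rewrite c_mod.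
Qed.

Lemma separated_notin_ball (g : 'I_3 -> 'I_n.+1) (k : 'I_N.+1) (c : 'I_q.+1) :
    (forall i j, i != j -> separated (g i) (g j)) -> index_set k = (g @: finset.setT)%SET ->
  k \notin ball 2 (S c).
Proof.
move=> g_sep kE; rewrite inE -ltnNge cardsD card_imset ?cardsT ?card_ord; last exact: word_pts_inj.
suff : (#|(S c) :&: index_set k|%SET <= 1)%N by set m := #|_|; lia.
apply/card_le1_eqP => x y; rewrite kE !inE.
move=> /andP[/imsetP[l _ xl] /imsetP[i _ xi]] /andP[/imsetP[l' _ yl] /imsetP[j _ yj]].
have [ij|/g_sep/andP[_ /negP[]]] := eqVneq i j; first by rewrite xi yj ij.
rewrite -xi -yj xl yl /word_pts !(val_block_elt qn) //.
have lt (m : 'I_3) : (m * q.+1 + c < 3 * q.+1)%N by have := (ltn_ord c); have := ltn_ord m; nia.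
by rewrite !modnMDl eqxx !lt.
Qed.

Lemma separated_index (p0 p1 p2 : 'I_n.+1) (P := fun i : 'I_3 => nth ord0 [:: p0; p1; p2] i) :
    separated p0 p1 -> separated p0 p2 -> separated p1 p2 ->
  [/\ injective P, exists k : 'I_N.+1, index_set k = (P @: finset.setT)%SET
    & forall (k : 'I_N.+1) (c : 'I_q.+1),
        index_set k = (P @: finset.setT)%SET -> k \notin ball 2 (S c)].
Proof.
move=> s01 s02 s12; have P_sep i j : i != j -> separated (P i) (P j).
  case: i j => [[|[|[|]]] // ?] [[|[|[|]]] // ?] //= _; by rewrite // separatedC.
have P_inj : injective P.
  by move=> i j Pij; apply: contraTeq isT => /P_sep/andP[]; rewrite Pij eqxx.
split=> // [|k c kE]; last exact: separated_notin_ball P_sep kE.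
by apply: index_set_surj => //; rewrite card_imset // cardsT card_ord.
Qed.

(** The 3 by 3 minor with rows [a], [b], [c], expanded as in [det_mx33]. *)
Let D (a b c : 'I_n.+1 -> F) p0 p1 p2 :=
  a p0 * (b p1 * c p2 - b p2 * c p1) - a p1 * (b p0 * c p2 - b p2 * c p0)
  + a p2 * (b p0 * c p1 - b p1 * c p0).

Section Kernel.
Variable X : nat -> 'I_n.+1 -> F.
Hypothesis eqn : forall p0 p1 p2, separated p0 p1 -> separated p0 p2 -> separated p1 p2 ->
  D (X 0) (extra_entry 1) (extra_entry 2) p0 p1 p2 +
  D (extra_entry 0) (X 1) (extra_entry 2) p0 p1 p2 +
  D (extra_entry 0) (extra_entry 1) (X 2) p0 p1 p2 = 0.
Hypotheses (X00 : X 0 (e 0 0) = 0) (X01 : X 0 (e 1 0) = 0) (X02 : X 0 (e 2 0) = 0).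
Hypotheses (X10 : X 1 (e 0 0) = 0) (X11 : X 1 (e 1 0) = 0) (X12 : X 1 (e 2 0) = 0).
Hypotheses (X20 : X 2 (e 0 0) = 0) (X21 : X 2 (e 1 0) = 0).

(** With two columns in block 1 and one in block 2 only row 0 contributes, so [X 0] is constant on
    the first four elements of block 1. The next five statements treat the other pairs of a row and
    a foreign block. *)
Let const01 i j k : (i < 4)%N -> (j < 4)%N -> (k < 4)%N -> i != j -> i != k -> j != k ->
  X 0 (e 1 i) - X 0 (e 1 j) = 0.
Proof.
by move=> *; rewrite -(eqn (p0 := e 1 i) (p1 := e 1 j) (p2 := e 2 k)) ?separated_block //;
   rewrite /D !extra_entry_block //=; ring.
Qed.

Let const02 i j k : (i < 4)%N -> (j < 4)%N -> (k < 4)%N -> i != j -> i != k -> j != k ->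
  X 0 (e 2 j) - X 0 (e 2 i) = 0.
Proof.
by move=> *; rewrite -(eqn (p0 := e 2 i) (p1 := e 2 j) (p2 := e 1 k)) ?separated_block //;
   rewrite /D !extra_entry_block //=; ring.
Qed.

Let const10 i j k : (i < 4)%N -> (j < 4)%N -> (k < 4)%N -> i != j -> i != k -> j != k ->
  X 1 (e 0 j) - X 1 (e 0 i) = 0.
Proof.
by move=> *; rewrite -(eqn (p0 := e 0 i) (p1 := e 0 j) (p2 := e 2 k)) ?separated_block //;
   rewrite /D !extra_entry_block //=; ring.
Qed.

Let const12 i j k : (i < 4)%N -> (j < 4)%N -> (k < 4)%N -> i != j -> i != k -> j != k ->
  X 1 (e 2 i) - X 1 (e 2 j) = 0.
Proof.
by move=> *; rewrite -(eqn (p0 := e 2 i) (p1 := e 2 j) (p2 := e 0 k)) ?separated_block //;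
   rewrite /D !extra_entry_block //=; ring.
Qed.

Let const20 i j k : (i < 4)%N -> (j < 4)%N -> (k < 4)%N -> i != j -> i != k -> j != k ->
  X 2 (e 0 i) - X 2 (e 0 j) = 0.
Proof.
by move=> *; rewrite -(eqn (p0 := e 0 i) (p1 := e 0 j) (p2 := e 1 k)) ?separated_block //;
   rewrite /D !extra_entry_block //=; ring.
Qed.

Let const21 i j k : (i < 4)%N -> (j < 4)%N -> (k < 4)%N -> i != j -> i != k -> j != k ->
  X 2 (e 1 j) - X 2 (e 1 i) = 0.
Proof.
by move=> *; rewrite -(eqn (p0 := e 1 i) (p1 := e 1 j) (p2 := e 0 k)) ?separated_block //;
   rewrite /D !extra_entry_block //=; ring.
Qed.

Let diag i j k : (i < 4)%N -> (j < 4)%N -> (k < 4)%N -> i != j -> i != k -> j != k ->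
  X 0 (e 0 i) + X 1 (e 1 j) + X 2 (e 2 k) = 0.
Proof.
by move=> *; rewrite -(eqn (p0 := e 0 i) (p1 := e 1 j) (p2 := e 2 k)) ?separated_block //;
   rewrite /D !extra_entry_block //=; ring.
Qed.

Let diag0 c : (c < 4)%N -> X 0 (e 0 c) = 0.
Proof.
have step j k : X 0 (e 0 c) + X 1 (e 1 j) + X 2 (e 2 k) = 0 ->
    X 0 (e 0 0) + X 1 (e 1 j) + X 2 (e 2 k) = 0 -> X 0 (e 0 c) = 0.
  by move=> Ec E0; move: Ec; rewrite -[RHS]E0 -!addrA => /addIr ->.
case: c step => [|[|[|[|]]]] // step _.
- by apply: (step 2%N 3%N); apply: diag.
- by apply: (step 1%N 3%N); apply: diag.
- by apply: (step 1%N 2%N); apply: diag.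
Qed.

Let diag1 c : (c < 4)%N -> X 1 (e 1 c) = 0.
Proof.
have step i k : X 0 (e 0 i) + X 1 (e 1 c) + X 2 (e 2 k) = 0 ->
    X 0 (e 0 i) + X 1 (e 1 0) + X 2 (e 2 k) = 0 -> X 1 (e 1 c) = 0.
  by move=> Ec E0; move: Ec; rewrite -[RHS]E0 => /addIr/addrI ->.
case: c step => [|[|[|[|]]]] // step _.
- by apply: (step 2%N 3%N); apply: diag.
- by apply: (step 1%N 3%N); apply: diag.
- by apply: (step 1%N 2%N); apply: diag.
Qed.

Let diag2 c : (c < 4)%N -> X 2 (e 2 c) = 0.
Proof.
have step i j : (i < 4)%N -> (j < 4)%N -> X 0 (e 0 i) + X 1 (e 1 j) + X 2 (e 2 c) = 0 ->
    X 2 (e 2 c) = 0 by move=> i4 j4; rewrite diag0 // diag1 // !add0r.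
case: c step => [|[|[|[|]]]] // step _.
- by apply: (step 1%N 2%N); last apply: diag.
- by apply: (step 0%N 2%N); last apply: diag.
- by apply: (step 0%N 1%N); last apply: diag.
- by apply: (step 0%N 1%N); last apply: diag.
Qed.

(** [X] is a tangent direction at the extra point with zero derivative in the separated coordinates.
    Row operations of trace zero always have this property; they form a space of dimension eight,
    which the eight normalizations remove. *)
Lemma extra_kernel i p : (i < 3)%N -> X i p = 0.
Proof.
move=> i3; have [/andP[p_lt p_mod]|p_in] := boolP ((p < 3 * q.+1) && (p %% q.+1 < 4))%N; last first.
  (* All rows of the extra point vanish at such a column, so the equation with [p] in place of an
     element of block [i] isolates [X i p]. *)
  have E0 j : (j < 3)%N -> extra_entry j p = 0.
    move=> j3; rewrite /extra_entry; case: eqP => //= pj; case: ltnP => // p_mod.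
    by move: p_in; rewrite p_mod andbT -ltn_divLR // pj j3.
  case: i i3 => [|[|[|]]] // _.
  - rewrite -(eqn (p0 := p) (p1 := e 1 0) (p2 := e 2 1)) ?separated_block ?separated_inactive //.
    by rewrite /D !extra_entry_block // !E0 //=; ring.
  - rewrite -(eqn (p0 := e 0 0) (p1 := p) (p2 := e 2 1)) ?separated_block //;
      try by rewrite ?[separated _ p]separatedC separated_inactive.
    by rewrite /D !extra_entry_block // !E0 //=; ring.
  - rewrite -(eqn (p0 := e 0 0) (p1 := e 1 1) (p2 := p)) ?separated_block //;
      try by rewrite ?[separated _ p]separatedC separated_inactive.
    by rewrite /D !extra_entry_block // !E0 //=; ring.
have l3 : (p %/ q.+1 < 3)%N by rewrite ltn_divLR.
have -> : p = e (p %/ q.+1) (p %% q.+1).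
  by apply: val_inj; rewrite /= (val_block_elt qn) ?ltn_mod // -divn_eq.
move: (p %/ q.+1)%N (p %% q.+1)%N l3 p_mod => l c {p p_lt}.
have shift (Y : nat -> F) : Y 0 = 0 -> (forall i j k, (i < 4)%N -> (j < 4)%N -> (k < 4)%N ->
    i != j -> i != k -> j != k -> Y i - Y j = 0) -> (c < 4)%N -> Y c = 0.
  move=> Y0 YE; case: c => [|[|[|[|]]]] // _.
  - by have := YE 1%N 0%N 2%N isT isT isT isT isT isT; rewrite Y0 subr0.
  - by have := YE 2%N 0%N 1%N isT isT isT isT isT isT; rewrite Y0 subr0.
  - by have := YE 3%N 0%N 1%N isT isT isT isT isT isT; rewrite Y0 subr0.
case: i i3 => [|[|[|]]] // _; case: l => [|[|[|]]] // _ c4.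
- exact: diag0.
- exact: (shift (fun j => X 0 (e 1 j)) X01 const01).
- apply: (shift (fun j => X 0 (e 2 j)) X02) => // i j k *.
  by apply: (@const02 j i k); rewrite // eq_sym.
- apply: (shift (fun j => X 1 (e 0 j)) X10) => // i j k *.
  by apply: (@const10 j i k); rewrite // eq_sym.
- exact: diag1.
- exact: (shift (fun j => X 1 (e 2 j)) X12 const12).
- exact: (shift (fun j => X 2 (e 0 j)) X20 const20).
- apply: (shift (fun j => X 2 (e 1 j)) X21) => // i j k *.
  by apply: (@const21 j i k); rewrite // eq_sym.
- exact: diag2.
Qed.

End Kernel.

Lemma not_defective_extra : ~ defective q.+2 (grassmannian F 2 n).
Proof.
pose pts (i : 'I_q.+1) := @word_pts 2 n q (fun=> i).
have pts_inj i : injective (pts i) by apply: word_pts_inj.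
pose M (i : 'I_q.+2) := if unlift ord_max i is Some j then coord_mx F (pts j) else extra_mx.
have M_lift j : M (lift ord_max j) = coord_mx F (pts j) by rewrite /M liftK.
have M_max : M ord_max = extra_mx by rewrite /M unlift_none.
have card_pts i : #|(pts i @: finset.setT)%SET| = 3%N by rewrite card_imset // cardsT card_ord.
have self_ball i k : index_set k = (pts i @: finset.setT)%SET -> k \in ball 2 (S i).
  by move=> kE; rewrite inE kE finset.setDv cards0.
apply: (@not_defective_of_rank F 2 n q.+2 M) => //.
  (* The coordinate of three elements with distinct letters is nonzero at the extra point and zero
     at all coordinate points. *)
  have [] := @separated_index (e 0 0) (e 1 1) (e 2 2); rewrite ?separated_block //.
  set P := fun i : 'I_3 => _; move=> P_inj [k kE] k_ball.
  have [s sE] := plucker_coord_imset F P_inj.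
  apply/rV0Pn; exists k; rewrite summxE (bigD1 ord_max) //= big1 ?addr0 => [|i].
    rewrite M_max pluckerE kE sE mulf_neq0 ?signr_eq0 //.
    have -> : colsub P extra_mx = 1%:M; last by rewrite det1 oner_eq0.
    apply/matrixP => -[[|[|[|]]] // ?] [[|[|[|]]] // ?]; rewrite !mxE /= extra_entry_block //.
  rewrite eq_sym => /unlift_some[j -> _]; rewrite M_lift.
  have [l lE] := index_set_surj n_ge2 (card_pts j).
  have [c _ ->] := plucker_coord_mx F n_ge2 (@pts_inj j) lE.
  rewrite !mxE /=; case: eqP => [kl|]; last by rewrite mulr0.
  by have := k_ball k j kE; rewrite kl self_ball.
set T := tangent_span M.
have TP i a w : (plucker (set_row a w (M i)) <= T)%MS by apply: plucker_tangent.
pose o i : 'I_3 := inord i.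
(* Of the [3 * n.+1] row replacements at the extra point eight are dropped, one for each dimension
   of the traceless row operations; [3 * (n - 2) + 1] remain. *)
pose Z := [:: (o 0, e 0 0); (o 0, e 1 0); (o 0, e 2 0); (o 1, e 0 0); (o 1, e 1 0);
              (o 1, e 2 0); (o 2, e 0 0); (o 2, e 1 0)]%N.
pose A := (~: [set x in Z])%SET.
pose Q (x : 'I_3 * 'I_n.+1) := plucker (set_row x.1 (delta_mx 0 x.2) extra_mx).
pose B := (\bigcup_(i < q.+1) ball 2 (S i))%SET.
have B_card : (q.+1 * (3 * (n - 2)).+1 <= #|B|)%N.
  apply: card_bigcup_ball => // i j ij; apply: word_pts_dist => //.
  by exists 0%N, 1%N, 2%N.
have A_card : ((3 * (n - 2)).+1 <= #|A|)%N.
  rewrite cardsCs finset.setCK card_prod !card_ord.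
  have : (#|[set x in Z]%SET| <= 8)%N by rewrite cardsE; apply: card_size.
  by set m := #|_|; lia.
apply: leq_trans (@rank_ge_unit_vectors _ _ _ T B _ A Q _ _ _).
- by rewrite mulSn addnC; apply: leq_add.
- move=> k /bigcupP[i _]; rewrite inE; apply: (coord_tangent n_ge2 (pts_inj i)) => a w.
  by rewrite -M_lift; apply: TP.
- by move=> x _; rewrite /Q -M_max; apply: TP.
move=> u uA uB [a p]; pose X i p := u (o i, p).
have -> : u (a, p) = X a p by rewrite /X /o inord_val.
have X0 i p' : (o i, p') \in Z -> X i p' = 0.
  by move=> iZ; apply: uA; rewrite finset.in_setC negbK finset.in_set.
apply: extra_kernel => //; try by apply: X0; rewrite !inE eqxx ?orbT.
move=> p0 p1 p2 s01 s02 s12; have [] := separated_index s01 s02 s12.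
set P := fun i : 'I_3 => _; move=> P_inj [k kE] k_ball.
have [s sE] := plucker_coord_imset F P_inj.
have kB : k \notin B by apply/bigcupP => -[i _]; apply/negP/k_ball.
have := uB k kB.
(* Grouped by row, the combination becomes the derivative in the direction with rows [X 0], [X 1],
   [X 2]. *)
have -> : \sum_x u x * Q x 0 k =
    \sum_a plucker (set_row a (\row_p u (a, p)) extra_mx) 0 k.
  rewrite (eq_bigr (fun x => u (x.1, x.2) * Q (x.1, x.2) 0 k)) => [|[]//].
  rewrite -(pair_bigA _ (fun a p => u (a, p) * Q (a, p) 0 k)) /=; apply: eq_bigr => b _.
  rewrite plucker_set_row_sum summxE; apply: eq_bigr => p' _.
  by rewrite !mxE.
pose f (b : 'I_3) (i j : nat) := if i == b then X i (nth ord0 [:: p0; p1; p2] j)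
  else extra_entry i (nth ord0 [:: p0; p1; p2] j).
have termE b : plucker (set_row b (\row_p u (b, p)) extra_mx) 0 k =
    (-1) ^+ s * \det (\matrix_(i < 3, j < 3) f b i j).
  rewrite pluckerE kE sE; congr (_ * \det _); apply/matrixP => i j; rewrite !mxE /f -val_eqE /=.
  by case: eqP => // ib; rewrite /X /o inord_val; congr (u (_, _)); apply/esym/val_inj.
under eq_bigr => b _ do rewrite termE det_mx33.
rewrite -mulr_sumr => /eqP; rewrite mulf_eq0 signr_eq0 /= => /eqP.
rewrite !big_ord_recl big_ord0 /f /= => eqn0; rewrite -[RHS]eqn0 /D; ring.
Qed.

End ExtraPoint.

(** * Numerical bounds *)

Section BinaryExponents.
Local Open Scope nat_scope.

Lemma sum_decreasing_powers a s (lambda : 'I_s -> nat) L :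
    (forall i j : 'I_s, i < j -> lambda j < lambda i) ->
    (forall i, 1 <= lambda i <= L) ->
  \sum_i a ^ lambda i <= \sum_(1 <= j < L.+1) a ^ j.
Proof.
elim: s lambda L => [|s IH] lambda L decr bnd; first by rewrite big_ord0.
have /andP[l0 lL] := bnd ord0; rewrite big_ord_recl.
apply: (@leq_trans (\sum_(1 <= j < (lambda ord0).+1) a ^ j)).
  rewrite big_nat_recr //= addnC leq_add2r -[X in index_iota 1 X](prednK l0).
  apply: IH => [i j ij|i]; first exact: decr.
  have lt : lambda (lift ord0 i) < lambda ord0 by apply: decr.
  by have /andP[-> _] := bnd (lift ord0 i); rewrite -ltnS prednK.
by rewrite [leqRHS](@big_cat_nat _ _ _ (lambda ord0).+1) //= leq_addr.
Qed.

Lemma sum_powers_lt a L : 2 <= a -> \sum_(1 <= j < L.+1) a ^ j < a ^ L.+1.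
Proof.
move=> a2; elim: L => [|L IH]; first by rewrite big_geq // expn_gt0; lia.
by rewrite big_nat_recr //= [a ^ L.+2]expnS; nia.
Qed.

Lemma leq_three_mul_exp L : 3 <= L -> 3 * L <= (2 ^ L).+1.
Proof.
elim: L => // L IH L3; have [L3'|] := leqP 3 L; first by have := IH L3'; rewrite expnS; lia.
by case: L L3 {IH} => [|[|[|]]].
Qed.

(** With [L] the largest exponent, [r] lies between [2 ^ L] and [2 ^ L.+1], and for [0 < q] the sum
    is at most [q.+1 ^ L.+1]. The exact value of [K] for [r = 2] is recorded for the use of the
    extra point. *)
Lemma binary_code q r s (lambda : 'I_s -> nat) eps :
    2 <= r -> (forall i j : 'I_s, i < j -> lambda j < lambda i) ->
    (forall i, 1 <= lambda i) -> eps <= 1 -> r = \sum_i 2 ^ lambda i + eps ->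
  exists2 K, has_code q r.+1 K &
    [/\ 0 < K, 0 < q -> \sum_i q.+1 ^ lambda i <= K & r = 2 -> K = q.+1].
Proof.
case: s lambda => [|s] lambda r_ge2 decr lambda_ge1 eps_le1 rE.
  by move: rE; rewrite big_ord0; lia.
set L := lambda ord0.
have bnd i : 1 <= lambda i <= L.
  rewrite lambda_ge1 /=; case: (unliftP ord0 i) => [j ->|-> //].
  by apply/ltnW/decr.
have L_ge1 : 1 <= L by apply: lambda_ge1.
have pow_L : 2 ^ L <= r by rewrite rE big_ord_recl -/L -addnA leq_addr.
have r_lt : r < 2 ^ L.+1.
  have := sum_decreasing_powers 2 decr bnd; have : (\sum_(1 <= j < L.+1) 2 ^ j).+2 = 2 ^ L.+1.
    elim: (L) => [|l IH]; first by rewrite big_geq.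
    by rewrite big_nat_recr //= -!addSn IH addnn -mul2n -expnS.
  by rewrite rE; lia.
have sum_le := sum_decreasing_powers q.+1 decr bnd.
have sum_lt : 0 < q -> \sum_i q.+1 ^ lambda i <= q.+1 ^ L.+1.
  by move=> q_gt0; apply: leq_trans sum_le (ltnW (sum_powers_lt _ _)).
(* The six-letter code with [L - 2] repetitions has length [3 * L], which fits into [r.+1] once [L]
   is at least [3]. *)
have [L_ge3|L_lt3] := leqP 3 L.
  exists (q.+1 ^ L.+1); last first.
    rewrite expn_gt0; split=> // r2; have := leq_three_mul_exp L_ge3.
    by move: pow_L; rewrite r2; lia.
  apply: has_codeW (_ : has_code q (6 + 3 * (L - 2)) _).
    by have := leq_three_mul_exp L_ge3; lia.
  have -> : L.+1 = 3 + (L - 2) by lia.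
  by rewrite expnD; apply/has_code_repeats/has_code6.
have [L1|L2] : L = 1 \/ L = 2 by lia.
  exists (q.+1 ^ 1); last by rewrite expn_gt0; split=> // _; move: sum_le; rewrite L1 big_nat1.
  apply: has_codeW (_ : has_code q (0 + 3 * 1) _); first by lia.
  by rewrite -[q.+1 ^ 1]mul1n; apply/has_code_repeats/has_code_unit.
(* For [r = 4] six letters do not fit, but then [2] is the only exponent and the five-letter code is
   large enough. *)
have [r4|r_neq4] := eqVneq r 4; last first.
  exists (q.+1 ^ 3); last first.
    rewrite expn_gt0; split=> // [/sum_lt|r2]; first by rewrite L2.
    by move: pow_L; rewrite L2 r2.
  by apply: has_codeW (has_code6 q); move: pow_L; rewrite L2; lia.
exists (q.+1 ^ 2); last first.
  rewrite expn_gt0; split=> // [_|]; last by rewrite r4.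
  rewrite big_ord_recl -/L L2.
  case: s lambda decr lambda_ge1 rE @L L2 {bnd L_ge1 pow_L r_lt sum_le sum_lt L_lt3} => [|s] lambda.
    by move=> *; rewrite big_ord0 addn0.
  move=> _ _ rE L L2; exfalso; move: rE; rewrite 2!big_ord_recl -/L L2 r4.
  have : 0 < 2 ^ lambda (lift ord0 ord0) by rewrite expn_gt0.
  by set x := 2 ^ lambda _; lia.
by apply: has_codeW (has_code5 q); rewrite r4.
Qed.

End BinaryExponents.

(** * The two bounds on [h] compared with the size of the code *)

Local Open Scope complex_scope.

Theorem mainTheorem1 (R : realType) (r n s : nat) (lambda : 'I_s -> nat)
    (eps h : nat)
    (alpha := (n.+1 %/ r.+1)%N)
    (r_ge2 : (2 <= r)%N) (n_ger : (r <= n)%N)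
    (lambda_decr : forall i j : 'I_s, (i < j)%N -> (lambda j < lambda i)%N)
    (lambda_ge1 : forall i : 'I_s, (1 <= lambda i)%N)
    (eps_le1 : (eps <= 1)%N)
    (r_binary : r = (\sum_(i < s) 2 ^ lambda i + eps)%N)
    (h_ge1 : (1 <= h)%N)
    (h_bound :
      (h <= (alpha - 1) * (\sum_(i < s) alpha ^ (lambda i - 1)) + 1)%N \/
      ((r ^ 2 + 3 * r + 1 <= n)%N /\
       (h <= \sum_(i < s) alpha ^ lambda i + 1)%N)) :
  ~ defective h (grassmannian R[i] r n).
Proof.
have alpha_gt0 : (0 < alpha)%N by rewrite divn_gt0.
have alpha_n : (r.+1 * alpha <= n.+1)%N by rewrite mulnC leq_divM.
(* The hypothesis amounts to [n.+1 >= r.+1 * r.+2]. *)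
have alpha_large : (r ^ 2 + 3 * r + 1 <= n)%N -> (r.+2 <= alpha)%N.
  by move=> n_large; rewrite leq_divRL //; move: n_large; rewrite -mulnn; lia.
move: alpha alpha_gt0 alpha_n alpha_large h_bound => [|q] // _ qn q_large h_bound.
have [K codeK [K_gt0 sum_le K2]] := binary_code q r_ge2 lambda_decr lambda_ge1 eps_le1 r_binary.
have [hK|hK] := leqP h K; first by apply: (not_defective_code qn) codeK _; rewrite ?h_ge1.
case: h_bound => [h_le|[n_large h_le]].
  (* The first bound never exceeds the code size: replacing [alpha - 1] by [alpha] adds a full copy
     of the sum, which is at least [1]. For [alpha = 1] the bound is just [1]. *)
  exfalso; move: hK; apply/negP; rewrite -leqNgt; apply: leq_trans h_le _.
  have [q0|q_gt0] := posnP q; first by rewrite q0.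
  apply: leq_trans (sum_le q_gt0); rewrite subn1 /=.
  rewrite [leqRHS](eq_bigr (fun i => q.+1 * q.+1 ^ (lambda i - 1))%N).
    rewrite -big_distrr /= mulSn addnC leq_add2r.
    case: s lambda {lambda_decr sum_le} lambda_ge1 r_binary => [|s] lambda _.
      by rewrite big_ord0; lia.
    by move=> _; rewrite big_ord_recl addn_gt0 expn_gt0.
  by move=> i _; rewrite -expnS subn1 prednK.
(* The second bound exceeds the code size by at most one, so exactly one further point is required,
   and [q] is large enough for either construction. *)
have rq := q_large n_large; have q_gt0 : (0 < q)%N by lia.
have h_eq : h = K.+1.
  by apply/eqP; rewrite eqn_leq hK andbT; apply: leq_trans h_le _; rewrite addn1 ltnS sum_le.
have [r2|r_neq2] := eqVneq r 2; last first.
  apply: (not_defective_code_block qn) codeK _ => //; [lia.. | by rewrite h_eq leqnn].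
by rewrite r2 in qn rq *; rewrite h_eq K2 //; apply: not_defective_extra.
Qed.
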